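(* For $\Omega=\mathbb B^2$, the unit ball of $\mathbb C^2$, there exist distinct points $a=\{a_1,\dots,a_4\}\subset\mathbb B^2$ and complex numbers $v=\{v_1,\dots,v_4\}$ such that the extremal problem for $(a,v)$ has a unique solution $f_0$, and $M(f_0)$ is a $2$-real-dimensional torus in $\partial\mathbb B^2$.
   Context: $H^\infty(\Omega)$ is the algebra of bounded holomorphic functions on $\Omega$ with the sup norm. A solution of the extremal problem for $(a,v)$ is a function $f\in H^\infty(\Omega)$ with $f(a_j)=v_j$ for all $j$ and $\|f\|_\infty=\inf\{\|h\|_\infty: h\in H^\infty(\Omega),\ h(a_j)=v_j\text{ for all } j\}$. For $f\in H^\infty(\Omega)$, $M(f)=\{\xi\in\partial\Omega:\limsup_{z\to\xi,\,z\in\Omega}|f(z)|=\|f\|_\infty\}$. *)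

(* Defs.v *)
From HB Require Import structures.
From mathcomp Require Import all_boot all_order all_algebra.
From mathcomp Require Import complex.
From mathcomp Require Import all_classical all_reals all_analysis.

Set Implicit Arguments.
Unset Strict Implicit.
Unset Printing Implicit Defensive.

Import Order.TTheory GRing.Theory Num.Theory.
Import numFieldNormedType.Exports.

Local Open Scope classical_set_scope.
Local Open Scope ring_scope.
Local Open Scope complex_scope.

(* Transfers the modulus topology of R[i] seen as a numFieldType. *)
HB.instance Definition _ (R : realType) :=
  NormedModule.copy R[i] (R[i])^o.

(* C^n is 'rV[R[i]]_n; its library norm is the max norm, so the Euclidean ball
   is written out. Functions on Omega are total functions on C^n whose values
   outside Omega are irrelevant; they are compared on Omega only. *)

Definition modulus (R : realType) (z : R[i]) : R := ComplexField.Normc.normc z.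

Definition unit_ball (R : realType) (n : nat) : set 'rV[R[i]]_n :=
  [set z | \sum_(j < n) modulus (z ord0 j) ^+ 2 < 1].
Arguments unit_ball R n : clear implicits.

Definition frontier (T : topologicalType) (A : set T) : set T :=
  closure A `\` interior A.

(* The scalar field is R[i], so [differentiable] is Frechet differentiability
   with a complex-linear differential. *)
Definition holomorphic_on (R : realType) (n : nat) (Omega : set 'rV[R[i]]_n)
    (f : 'rV[R[i]]_n -> R[i]) : Prop :=
  forall z, Omega z -> differentiable f z.

Definition sup_norm (R : realType) (n : nat) (Omega : set 'rV[R[i]]_n)
    (f : 'rV[R[i]]_n -> R[i]) : \bar R :=
  ereal_sup [set (modulus (f z))%:E | z in Omega].

Definition Hinfty (R : realType) (n : nat) (Omega : set 'rV[R[i]]_n) :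
    set ('rV[R[i]]_n -> R[i]) :=
  [set f | holomorphic_on Omega f /\ (sup_norm Omega f < +oo)%E].

Definition interpolants (R : realType) (n N : nat) (Omega : set 'rV[R[i]]_n)
    (a : 'I_N -> 'rV[R[i]]_n) (v : 'I_N -> R[i]) :
    set ('rV[R[i]]_n -> R[i]) :=
  [set f | Hinfty Omega f /\ forall j, f (a j) = v j].

Definition extremal_solution (R : realType) (n N : nat)
    (Omega : set 'rV[R[i]]_n) (a : 'I_N -> 'rV[R[i]]_n) (v : 'I_N -> R[i])
    (f : 'rV[R[i]]_n -> R[i]) : Prop :=
  interpolants Omega a v f /\
  sup_norm Omega f =
    ereal_inf [set sup_norm Omega h | h in interpolants Omega a v].

Definition max_modulus_set (R : realType) (n : nat) (Omega : set 'rV[R[i]]_n)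
    (f : 'rV[R[i]]_n -> R[i]) : set 'rV[R[i]]_n :=
  [set xi | frontier Omega xi /\
    limf_esup (fun z => (modulus (f z))%:E) (within Omega (nbhs xi))
      = sup_norm Omega f].

Definition realify (R : realType) (n : nat) (z : 'rV[R[i]]_n) :
    'rV[R]_(n + n) :=
  row_mx (map_mx (@complex.Re R) z) (map_mx (@complex.Im R) z).

Fixpoint Ck (R : realType) (m p k : nat) (g : 'rV[R]_m -> 'rV[R]_p) : Prop :=
  match k with
  | 0 => continuous g
  | k'.+1 => (forall x, differentiable g x) /\
      forall i : 'I_m, Ck k' (fun x => 'D_(delta_mx ord0 i) g x)
  end.

Definition smooth (R : realType) (m p : nat) (g : 'rV[R]_m -> 'rV[R]_p) :
    Prop :=
  forall k, Ck k g.

(* M is the image of a smooth map on R^d that factors through an injective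
   immersion of the torus R^d / Z^d; by compactness the latter is a smooth
   embedding. In particular M is homeomorphic to (S^1)^d. *)
Definition is_torus (R : realType) (d n : nat) (M : set 'rV[R[i]]_n) : Prop :=
  exists phi : 'rV[R]_d -> 'rV[R[i]]_n,
    [/\ smooth (fun t => realify (phi t)),
        (forall t u, 'd (fun s => realify (phi s)) t u = 0 -> u = 0),
        (forall s t, phi s = phi t <->
           exists m : 'rV[int]_d, s - t = map_mx intr m) &
        M = range phi].

(* Main.v *)
Require Import Defs.
From mathcomp Require Import all_boot all_order all_algebra.
From mathcomp Require Import complex ring lra.
From mathcomp Require Import all_classical all_reals all_analysis.

Set Implicit Arguments.
Unset Strict Implicit.
Unset Printing Implicit Defensive.

Import Order.TTheory GRing.Theory Num.Theory.
Import numFieldNormedType.Exports.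

Local Open Scope classical_set_scope.
Local Open Scope ring_scope.
Local Open Scope complex_scope.

(** The extremal function is 2 x y, with nodes at the origin, at (1/2, 1/2), at
    its opposite and at (1/2, -1/2). On the closed ball 2 |x| |y| is at most
    |x|^2 + |y|^2 <= 1, with equality to 1 only on the torus
    |x| = |y| = 1 / sqrt 2. So everything rests on uniqueness: a holomorphic f
    bounded by 1 on the ball with the same values at the nodes is 2 x y
    ([four_point_uniqueness]). In particular no interpolant has smaller norm.

    In the coordinates a = (x + y) / sqrt 2, b = (x - y) / sqrt 2 the target is
    a^2 - b^2, three nodes lie on the axis b = 0 and the fourth on a = 0.
    The three-point Pick problem on the disc b = 0 is extremal, so
    f (a, 0) = a^2 ([axis_square]). The ball contains the discs (u z, v z^2)
    with |u|^2 + |v|^2 <= 1, on which f has a double zero and is hence at most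
    |z|^2. Those discs pass so close to the axis that the derivative of f in the
    direction b must vanish there ([tangent_bound],
    [vertical_quadratic_bound]). Thus f (0, b) also has a double zero, and the
    value at the fourth node is the largest that Schwarz's lemma permits, which
    gives f (0, b) = - b^2 ([other_axis_square]). The terms of f of degree at
    most 2 are now those of a^2 - b^2 ([mixed_bound]). On a complex line through
    a point of the torus, f (z w) / z^2 is bounded by 1 with a unimodular value
    at 0, so it is constant ([peak_line]). Therefore f = 2 x y whenever
    |x| = |y|, then near 0 by the maximum principle in one variable, then along
    all lines through 0.

    The theory of one complex variable that this uses (Cauchy's formula, the
    maximum principle, the lemmas of Schwarz and Schwarz-Pick) is developed for
    functions that are merely complex differentiable at each point. Integrals
    are replaced by trapezoid sums over dyadic subdivisions, which are exact on
    affine functions and add up over subsquares; Goursat's bisection then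
    applies to images of the unit square under Lipschitz maps ([goursat]).
    Deforming a circle into a small one gives Cauchy's formula as a limit of
    means over roots of unity ([cauchy_formula]); the maximum principle follows
    by applying it to powers ([maximum_principle]), and the removability of
    divided differences by expanding its kernel ([divided_difference]). *)

(** * The modulus of a complex number *)

Section Modulus.
Variable R : realType.
Notation C := R[i].
Implicit Types (z w : C) (x : R) (n : nat).

Lemma modulusE z : `|z| = (modulus z)%:C. Proof. by []. Qed.

Lemma modulus_ge0 z : 0 <= modulus z.
Proof. by rewrite -lecR -modulusE normr_ge0. Qed.

Lemma modulus0 : modulus (0 : C) = 0.
Proof. exact: ComplexField.Normc.normc0. Qed.

Lemma modulus1 : modulus (1 : C) = 1.
Proof. exact: ComplexField.Normc.normc1. Qed.

Lemma modulus_eq0 z : modulus z = 0 -> z = 0.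
Proof. exact: ComplexField.Normc.eq0_normc. Qed.

Lemma modulus_gt0 z : (0 < modulus z) = (z != 0).
Proof.
rewrite lt_neqAle modulus_ge0 andbT eq_sym; congr negb.
by apply/eqP/eqP => [/modulus_eq0|->]; rewrite ?modulus0.
Qed.

Lemma modulusM z w : modulus (z * w) = modulus z * modulus w.
Proof. exact: ComplexField.Normc.normcM. Qed.

Lemma modulusV z : modulus z^-1 = (modulus z)^-1.
Proof. exact: ComplexField.Normc.normcV. Qed.

Lemma modulusX z n : modulus (z ^+ n) = modulus z ^+ n.
Proof.
by elim: n => [|n IH]; rewrite ?expr0 ?modulus1// !exprS modulusM IH.
Qed.

Lemma modulus_nat n : modulus (n%:R : C) = n%:R.
Proof.
rewrite -(rmorph_nat (@real_complex R)).
by rewrite /modulus/= expr0n/= addr0 sqrtr_sqr normr_nat.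
Qed.

Lemma modulusN z : modulus (- z) = modulus z.
Proof. by apply: complexI; rewrite -!modulusE normrN. Qed.

Lemma modulusB z w : modulus (z - w) = modulus (w - z).
Proof. by rewrite -modulusN opprB. Qed.

Lemma modulusD z w : modulus (z + w) <= modulus z + modulus w.
Proof. by rewrite -lecR rmorphD/= -!modulusE ler_normD. Qed.

Lemma modulus_real x : modulus x%:C = `|x|.
Proof. by rewrite /modulus/= expr0n/= addr0 sqrtr_sqr. Qed.

Lemma modulus_sqr z :
  modulus z ^+ 2 = complex.Re z ^+ 2 + complex.Im z ^+ 2.
Proof. by case: z => x y /=; rewrite sqr_sqrtr// addr_ge0// sqr_ge0. Qed.

Lemma modulus_conj z : modulus z^*%C = modulus z.
Proof. by case: z => x y; rewrite /modulus/= sqrrN. Qed.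

Lemma modulus_dist z w : modulus z - modulus w <= modulus (z - w).
Proof. by rewrite lerBlDr (le_trans _ (modulusD _ _))// subrK. Qed.

Lemma ler_Re_modulus z : `|complex.Re z| <= modulus z.
Proof.
rewrite -(ler_pXn2r (n := 2)) ?nnegrE ?modulus_ge0// modulus_sqr.
by rewrite real_normK ?num_real// lerDl sqr_ge0.
Qed.

Lemma ler_Im_modulus z : `|complex.Im z| <= modulus z.
Proof.
rewrite -(ler_pXn2r (n := 2)) ?nnegrE ?modulus_ge0// modulus_sqr.
by rewrite real_normK ?num_real// lerDr sqr_ge0.
Qed.

Lemma modulus_ReIm z : modulus z <= `|complex.Re z| + `|complex.Im z|.
Proof.
rewrite -(ler_pXn2r (n := 2)) ?nnegrE ?modulus_ge0 ?addr_ge0//.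
rewrite modulus_sqr sqrrD !real_normK ?num_real//.
by rewrite -addrA lerD2l lerDr mulrn_wge0// mulr_ge0.
Qed.

Lemma modulus_sum (I : Type) (r : seq I) (P : pred I) (F : I -> C) :
  modulus (\sum_(i <- r | P i) F i) <= \sum_(i <- r | P i) modulus (F i).
Proof.
elim/big_ind2 : _ => [|x a y b xa yb|//]; first by rewrite modulus0.
by rewrite (le_trans (modulusD _ _))// lerD.
Qed.

(** The norm of a complex number is itself complex, and so are the radii of
    balls; real radii make estimates available in an ordered field. *)
Lemma nbhs_modulusP z (A : set C) :
  nbhs z A <-> exists2 d : R, 0 < d & forall w, modulus (w - z) < d -> A w.
Proof.
split=> [|[d d0 dA]].
  move=> /nbhs_ballP[[e i]/= e0 eA].
  move: e0; rewrite ltcE/= => /andP[/eqP i0 e0].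
  exists e => // w wz; apply: eA; rewrite /ball/= i0.
  by rewrite distrC modulusE ltcR.
apply/nbhs_ballP; exists d%:C => /=; first by rewrite ltcR.
move=> w; rewrite /ball/= distrC modulusE ltcR; exact: dA.
Qed.

(** The error bound is real, again to estimate in an ordered field. *)
Lemma differentiable_modulusP (G : C -> C) z :
  differentiable G z <-> exists l : C, forall e : R, 0 < e ->
    exists2 d : R, 0 < d & forall w, modulus (w - z) < d ->
      modulus (G w - G z - l * (w - z)) <= e * modulus (w - z).
Proof.
rewrite -derivable1_diffP; split.
  move=> /cvg_ex[l lG]; exists l => e e0.
  move/cvgrPdist_le : lG => /(_ e%:C).
  rewrite ltcR => /(_ e0)/nbhs_modulusP[d d0 dG].
  exists d => // w wz; have [->|wnz] := eqVneq w z.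
    by rewrite !subrr mulr0 subrr modulus0 mulr0.
  move: (dG (w - z)); rewrite subr0 => /(_ wz); rewrite subr_eq0 => /(_ wnz).
  rewrite /= /GRing.scale/= mulr1 subrK modulusE lecR => H.
  have wz0 : w - z != 0 by rewrite subr_eq0.
  have -> : G w - G z - l * (w - z)
     = - (l - (w - z)^-1 * (G w - G z)) * (w - z).
    by field.
  by rewrite modulusM modulusN ler_wpM2r// modulus_ge0.
move=> [l H]; apply/cvg_ex; exists l; apply/cvgrPdist_le => -[e i] /=.
rewrite ltcE/= => /andP[/eqP -> e0].
have [d d0 dG] := H _ e0.
apply/nbhs_modulusP; exists d => // w; rewrite subr0 => wd w0.
rewrite /= /GRing.scale/= mulr1 modulusE lecR.
have := dG (w + z); rewrite addrK => /(_ wd) H1.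
rewrite -(ler_pM2r (x := modulus w)) ?modulus_gt0// -modulusM.
have -> : (l - w^-1 * (G (w + z) - G z)) * w = - (G (w + z) - G z - l * w).
  by field.
by rewrite modulusN.
Qed.

Lemma differentiable_cont_modulus (G : C -> C) z : differentiable G z ->
  forall e : R, 0 < e -> exists2 d : R, 0 < d &
    forall w, modulus (w - z) < d -> modulus (G w - G z) <= e.
Proof.
move=> /differentiable_modulusP[l /(_ 1 ltr01)[d d0 H]] e e0.
have l0 : 0 < modulus l + 1 by rewrite ltr_wpDl// modulus_ge0.
exists (Num.min d (e / (modulus l + 1))).
  by rewrite lt_min d0 divr_gt0.
move=> w; rewrite lt_min => /andP[/H{}H we].
have -> : G w - G z = (G w - G z - l * (w - z)) + l * (w - z) by ring.
rewrite (le_trans (modulusD _ _))// (le_trans (lerD H (lexx _)))// modulusM.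
rewrite -mulrDl addrC mulrC -ler_pdivlMr//; exact: ltW.
Qed.

End Modulus.

(** * Dyadic subdivision of the unit square *)

Section DyadicCousin.
Variable R : realType.
Implicit Types (s t h : R) (Good : R -> R -> R -> Prop).

Let quarter Good (k : nat) (c : R * R) : R * R :=
  let h := 2^-1 ^+ k.+1 in
  if `[< ~ Good c.1 c.2 h >] then c
  else if `[< ~ Good (c.1 + h) c.2 h >] then (c.1 + h, c.2)
  else if `[< ~ Good c.1 (c.2 + h) h >] then (c.1, c.2 + h)
  else (c.1 + h, c.2 + h).

Let corner Good := fix corner k : R * R :=
  if k is k'.+1 then quarter Good k' (corner k') else (0, 0).

Let half_pow (k : nat) : 2^-1 ^+ k = 2^-1 ^+ k.+1 + 2^-1 ^+ k.+1 :> R.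
Proof. by rewrite !exprS; lra. Qed.

Let nested_le (u : nat -> R) :
  (forall k, u k <= u k.+1) ->
  (forall k, u k.+1 + 2^-1 ^+ k.+1 <= u k + 2^-1 ^+ k) ->
  exists x, forall k, u k <= x <= u k + 2^-1 ^+ k.
Proof.
move=> u_le v_le.
have uM := (nondecreasing_seqP u).1 u_le.
have vM i j : (i <= j)%N -> u j + 2^-1 ^+ j <= u i + 2^-1 ^+ i.
  elim: j => [|j IH]; first by rewrite leqn0 => /eqP->.
  rewrite leq_eqVlt => /orP[/eqP->//|ij].
  exact: le_trans (v_le _) (IH _).
have uv i j : u i <= u j + 2^-1 ^+ j.
  have p k : u k <= u k + 2^-1 ^+ k by rewrite lerDl exprn_ge0.
  case: (leqP i j) => [ij|/ltnW ji].
    exact: le_trans (uM _ _ ij) (p _).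
  exact: le_trans (p _) (vM _ _ ji).
exists (sup (range u)) => k; apply/andP; split.
  apply: ub_le_sup; last by exists k.
  by exists (u 0 + 2^-1 ^+ 0) => _ [i _ <-].
by apply: ge_sup => [|_ [i _ <-]//]; exists (u 0%N), 0%N.
Qed.

(** If the unit square were bad, repeated bisection would give bad squares
    shrinking to a point, against the local hypothesis. This is the step that
    makes differentiability at each point suffice, without any uniformity. *)
Lemma dyadic_cousin Good :
  (forall s t h, Good s t (h / 2) -> Good (s + h / 2) t (h / 2) ->
     Good s (t + h / 2) (h / 2) -> Good (s + h / 2) (t + h / 2) (h / 2) ->
     Good s t h) ->
  (forall s t, 0 <= s <= 1 -> 0 <= t <= 1 -> exists2 d : R, 0 < d &
     forall s' t' h, 0 < h < d -> 0 <= s' -> s' + h <= 1 -> 0 <= t' ->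
       t' + h <= 1 -> s' <= s <= s' + h -> t' <= t <= t' + h ->
       Good s' t' h) ->
  Good 0 0 1.
Proof.
move=> Gsub Gloc; apply: contrapT => bad.
pose c := corner Good.
have cS k : c k.+1 = quarter Good k (c k) by [].
have badc k : ~ Good (c k).1 (c k).2 (2^-1 ^+ k).
  elim: k => [|k IH]; first by rewrite expr0.
  rewrite cS /quarter.
  have E : 2^-1 ^+ k.+1 = 2^-1 ^+ k / 2 :> R by rewrite exprS mulrC.
  case: asboolP => //= /contrapT G1.
  case: asboolP => //= /contrapT G2.
  case: asboolP => //= /contrapT G3.
  by move=> G4; apply: IH; apply: Gsub; rewrite -?E.
have h_gt0 k : 0 < 2^-1 ^+ k :> R by rewrite exprn_gt0.
have c1 k : (c k).1 <= (c k.+1).1 /\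
    (c k.+1).1 + 2^-1 ^+ k.+1 <= (c k).1 + 2^-1 ^+ k.
  have := h_gt0 k.+1; have := half_pow k; rewrite cS /quarter.
  by do 3?case: ifP => _ /=; lra.
have c2 k : (c k).2 <= (c k.+1).2 /\
    (c k.+1).2 + 2^-1 ^+ k.+1 <= (c k).2 + 2^-1 ^+ k.
  have := h_gt0 k.+1; have := half_pow k; rewrite cS /quarter.
  by do 3?case: ifP => _ /=; lra.
have [s sP] := nested_le (fun k => (c1 k).1) (fun k => (c1 k).2).
have [t tP] := nested_le (fun k => (c2 k).1) (fun k => (c2 k).2).
have in01 k : [/\ 0 <= (c k).1, (c k).1 + 2^-1 ^+ k <= 1,
                  0 <= (c k).2 & (c k).2 + 2^-1 ^+ k <= 1].
  elim: k => [|k [? ? ? ?]]; first by rewrite expr0/=; split; lra.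
  have := c1 k; have := c2 k.
  by split; lra.
have s01 : 0 <= s <= 1 by have := sP 0%N; rewrite expr0/= add0r.
have t01 : 0 <= t <= 1 by have := tP 0%N; rewrite expr0/= add0r.
have [d d0 dG] := Gloc s t s01 t01.
pose k := Num.bound d^-1.
have [i1 i2 i3 i4] := in01 k.
apply: (badc k); apply: dG => //.
rewrite h_gt0/= exprVn -[ltRHS]invrK ltf_pV2 ?posrE ?exprn_gt0 ?invr_gt0//.
exact: upper_nthrootP.
Qed.

End DyadicCousin.

(** * Goursat's theorem for trapezoid sums *)

Section Goursat.
Variable R : realType.
Notation C := R[i].
Implicit Types (K : C -> C) (z w p l : C) (a h s t : R) (N n : nat).

Definition trapezoid K z w : C := (K z + K w) * (w - z).

Definition curve_sum K (g : R -> C) N a h : C :=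
  \sum_(k < N) trapezoid K (g (a + h * (k%:R / N%:R)))
                           (g (a + h * (k.+1%:R / N%:R))).

Definition square_sum K (P : R -> R -> C) N s t h : C :=
  curve_sum K (P^~ t) N s h + curve_sum K (P (s + h)) N t h
  - curve_sum K (P^~ (t + h)) N s h - curve_sum K (P s) N t h.

Lemma curve_sum_double K (g : R -> C) N a h : (0 < N)%N ->
  curve_sum K g (N + N) a h =
  curve_sum K g N a (h / 2) + curve_sum K g N (a + h / 2) (h / 2).
Proof.
move=> N0; rewrite /curve_sum big_split_ord/=.
have N0' : N%:R != 0 :> R by rewrite pnatr_eq0 -lt0n.
have NN0 : N%:R + N%:R != 0 :> R.
  by rewrite -natrD pnatr_eq0 -lt0n ltn_addl.
congr (_ + _); apply: eq_bigr => k _; congr trapezoid; congr g;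
  rewrite -?addnS !natrD -?addrA; congr (_ + _); field; by rewrite NN0 N0'.
Qed.

Lemma square_sum_double K (P : R -> R -> C) N s t h : (0 < N)%N ->
  square_sum K P (N + N) s t h =
  square_sum K P N s t (h / 2) + square_sum K P N (s + h / 2) t (h / 2)
  + square_sum K P N s (t + h / 2) (h / 2)
  + square_sum K P N (s + h / 2) (t + h / 2) (h / 2).
Proof.
move=> N0; rewrite /square_sum !curve_sum_double//.
have E x : x + h / 2 + h / 2 = x + h by lra.
by rewrite !E; ring.
Qed.

(** Twice a primitive of the affine function K0 + l (z - p). *)
Definition twice_primitive (K0 l p z : C) : C :=
  2 * K0 * z + l * (z - p) ^+ 2.

(** Trapezoid sums integrate affine functions exactly, so only the error of the
    affine approximation of [K] counts. *)
Lemma curve_sum_affine K (g : R -> C) N a h p (K0 l : C) (e L : R) :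
  (0 < N)%N -> 0 <= h -> 0 <= L ->
  (forall x y, a <= x <= a + h -> a <= y <= a + h ->
     modulus (g x - g y) <= L * `|x - y|) ->
  (forall x, a <= x <= a + h ->
     modulus (K (g x) - K0 - l * (g x - p)) <= e) ->
  modulus (curve_sum K g N a h
    - (twice_primitive K0 l p (g (a + h)) - twice_primitive K0 l p (g a)))
    <= 2 * e * (L * h).
Proof.
move=> N0 h0 L0 gL Ke; set Psi := twice_primitive _ _ _.
have N0' : 0 < N%:R :> R by rewrite ltr0n.
pose x (k : nat) := a + h * (k%:R / N%:R).
have xa (k : nat) : (k <= N)%N -> a <= x k <= a + h.
  move=> kN; rewrite /x lerDl lerD2l mulr_ge0 ?divr_ge0//=.
  by rewrite ler_piMr// ler_pdivrMr// mul1r ler_nat.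
have e0 : 0 <= e.
  by apply: le_trans (modulus_ge0 _) (Ke a _); rewrite lexx/= lerDl.
have -> : Psi (g (a + h)) - Psi (g a) =
    \sum_(k < N) (Psi (g (x k.+1)) - Psi (g (x k))).
  rewrite -(big_mkord xpredT (fun k => Psi (g (x k.+1)) - Psi (g (x k)))).
  rewrite telescope_sumr//.
  by rewrite /x mul0r mulr0 addr0 divff ?gt_eqF// mulr1.
rewrite /curve_sum -sumrB.
rewrite (le_trans (modulus_sum _ _ _))//.
have -> : 2 * e * (L * h) = \sum_(k < N) 2 * e * (L * (h / N%:R)).
  rewrite sumr_const card_ord -mulr_natl.
  by field; rewrite gt_eqF.
apply: ler_sum => k _; rewrite -!/(x _).
have xk := xa k (ltnW (ltn_ord k)); have xk1 := xa k.+1 (ltn_ord k).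
have -> : trapezoid K (g (x k)) (g (x k.+1)) - (Psi (g (x k.+1)) - Psi (g (x k)))
  = ((K (g (x k)) - K0 - l * (g (x k) - p))
     + (K (g (x k.+1)) - K0 - l * (g (x k.+1) - p))) * (g (x k.+1) - g (x k)).
  by rewrite /trapezoid /Psi /twice_primitive; ring.
rewrite modulusM; apply: ler_pM; rewrite ?modulus_ge0//.
  rewrite (le_trans (modulusD _ _))// mulr2n mulrDl mul1r.
  by apply: lerD; exact: Ke.
rewrite (le_trans (gL _ _ xk1 xk))// ler_wpM2l//.
have -> : x k.+1 - x k = h / N%:R.
  by rewrite /x -natr1; field; rewrite gt_eqF.
by rewrite ger0_norm ?divr_ge0.
Qed.

(** Goursat: on a small square around a point the sum is o(h^2), and the sums
    of subsquares add up, so [dyadic_cousin] applies. *)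
Lemma goursat K (P : R -> R -> C) (L : R) : 0 <= L ->
  (forall s t s' t', 0 <= s <= 1 -> 0 <= t <= 1 -> 0 <= s' <= 1 ->
     0 <= t' <= 1 ->
     modulus (P s t - P s' t') <= L * (`|s - s'| + `|t - t'|)) ->
  (forall s t, 0 <= s <= 1 -> 0 <= t <= 1 -> differentiable K (P s t)) ->
  forall e, 0 < e -> exists n0 : nat, forall n, (n0 <= n)%N ->
    modulus (square_sum K P (2 ^ n) 0 0 1) <= e.
Proof.
move=> L0 PL dK e e0.
pose Good s t h := exists n0 : nat, forall n, (n0 <= n)%N ->
    modulus (square_sum K P (2 ^ n) s t h) <= e * h ^+ 2.
suff : Good 0 0 1 by rewrite /Good expr1n mulr1.
apply: dyadic_cousin.
  move=> s t h [n1 H1] [n2 H2] [n3 H3] [n4 H4].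
  exists (maxn (maxn n1 n2) (maxn n3 n4)).+1 => -[//|n].
  rewrite ltnS !geq_max => /andP[/andP[h1 h2] /andP[h3 h4]].
  rewrite expnS mul2n -addnn square_sum_double ?expn_gt0//.
  rewrite (le_trans (modulusD _ _))//.
  have := H4 _ h4; have := H3 _ h3; have := H2 _ h2; have := H1 _ h1.
  have := modulusD (square_sum K P (2 ^ n) s t (h / 2)
    + square_sum K P (2 ^ n) (s + h / 2) t (h / 2))
    (square_sum K P (2 ^ n) s (t + h / 2) (h / 2)).
  have := modulusD (square_sum K P (2 ^ n) s t (h / 2))
    (square_sum K P (2 ^ n) (s + h / 2) t (h / 2)).
  have -> : e * (h / 2) ^+ 2 = (e * h ^+ 2) / 4 by field.
  by lra.
move=> s t s01 t01.
have [l Kl] := (differentiable_modulusP _ _).1 (dK _ _ s01 t01).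
(* Each of the four sides of a square of side h has length at most L h and lies
   within 2 L h of the given point; with the 2 of [curve_sum_affine] this makes
   the factor 4 * 2 * 2 * L ^+ 2. *)
pose eta := e / (16 * L ^+ 2 + 1).
have M0 : 0 < 16 * L ^+ 2 + 1 by rewrite ltr_wpDl// mulr_ge0// sqr_ge0.
have eta0 : 0 < eta by rewrite divr_gt0.
have [d d0 Kd] := Kl _ eta0.
have L1 : 0 < 2 * L + 1 by lra.
exists (d / (2 * L + 1)); first by rewrite divr_gt0.
move=> s' t' h /andP[h0]; rewrite ltr_pdivlMr// => hd s'0 s'1 t'0 t'1 ss tt.
exists 0%N => n _.
have N0 : (0 < 2 ^ n)%N by rewrite expn_gt0.
have near_p x y : s' <= x <= s' + h -> t' <= y <= t' + h ->
    modulus (P x y - P s t) <= 2 * L * h.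
  move=> xs yt; rewrite (le_trans (PL _ _ _ _ _ _ _ _))//; try lra.
  rewrite -mulrA mulrCA; apply: ler_wpM2l => //.
  rewrite -[2 * h]/((1 + 1) * h) mulrDl mul1r; apply: lerD; rewrite ler_norml; lra.
have Kp x y : s' <= x <= s' + h -> t' <= y <= t' + h ->
    modulus (K (P x y) - K (P s t) - l * (P x y - P s t))
      <= eta * (2 * L * h).
  move=> xs yt; have H := near_p _ _ xs yt.
  rewrite (le_trans (Kd _ _))//; first by rewrite (le_lt_trans H)//; lra.
  by rewrite ler_wpM2l// ltW.
have lip_s y x x' : t' <= y <= t' + h -> s' <= x <= s' + h ->
    s' <= x' <= s' + h -> modulus (P x y - P x' y) <= L * `|x - x'|.
  move=> ? ? ?; rewrite (le_trans (PL _ _ _ _ _ _ _ _))//; try lra.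
  by rewrite subrr normr0 addr0.
have lip_t x y y' : s' <= x <= s' + h -> t' <= y <= t' + h ->
    t' <= y' <= t' + h -> modulus (P x y - P x y') <= L * `|y - y'|.
  move=> ? ? ?; rewrite (le_trans (PL _ _ _ _ _ _ _ _))//; try lra.
  by rewrite subrr normr0 add0r.
have ss0 : s' <= s' <= s' + h by lra.
have ss1 : s' <= s' + h <= s' + h by lra.
have tt0 : t' <= t' <= t' + h by lra.
have tt1 : t' <= t' + h <= t' + h by lra.
have S1 := curve_sum_affine N0 (ltW h0) L0 (fun x x' => @lip_s _ x x' tt0)
  (fun x => Kp x _ ^~ tt0).
have S2 := curve_sum_affine N0 (ltW h0) L0 (fun y y' => @lip_t _ y y' ss1)
  (fun y => Kp _ y ss1).
have S3 := curve_sum_affine N0 (ltW h0) L0 (fun x x' => @lip_s _ x x' tt1)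
  (fun x => Kp x _ ^~ tt1).
have S4 := curve_sum_affine N0 (ltW h0) L0 (fun y y' => @lip_t _ y y' ss0)
  (fun y => Kp _ y ss0).
have -> : e * h ^+ 2 =
    4 * (2 * (eta * (2 * L * h)) * (L * h)) + eta * h ^+ 2.
  by rewrite /eta; field; rewrite gt_eqF.
apply: (@le_trans _ _ (4 * (2 * (eta * (2 * L * h)) * (L * h)))); last first.
  by rewrite lerDl mulr_ge0 ?ltW// exprn_gt0.
move: S1 S2 S3 S4; set E := 2 * _ * (L * h).
set u1 := (X in modulus X <= _) => S1.
set u2 := (X in modulus X <= _) => S2.
set u3 := (X in modulus X <= _) => S3.
set u4 := (X in modulus X <= _) => S4.
have -> : square_sum K P (2 ^ n) s' t' h = u1 + u2 - u3 - u4.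
  by rewrite /u1 /u2 /u3 /u4 /square_sum; ring.
have := modulusD (u1 + u2 - u3) (- u4).
have := modulusD (u1 + u2) (- u3); have := modulusD u1 u2.
by rewrite !modulusN; lra.
Qed.

End Goursat.

(** * Means over roots of unity and Cauchy's formula *)

Section Circle.
Variable R : realType.
Notation C := R[i].
Implicit Types (K G : C -> C) (z w c : C) (r e s t x y : R) (N n k : nat).

(** This is e^(2 pi i t), the unit being a full turn. *)
Definition turn t : C := cos (2 * pi * t) +i* sin (2 * pi * t).

Lemma turnD s t : turn (s + t) = turn s * turn t.
Proof.
rewrite /turn mulrDr cosD sinD; apply/eqP; rewrite eq_complex/=.
by rewrite [X in _ && (X == _)]addrC !eqxx.
Qed.

Lemma turn0 : turn 0 = 1.
Proof. by rewrite /turn mulr0 cos0 sin0. Qed.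

Lemma turn1 : turn 1 = 1.
Proof.
by rewrite /turn mulr1 mulr_natl cos2pi sin2pi.
Qed.

Lemma turn_half : turn 2^-1 = -1.
Proof.
rewrite /turn mulrAC divff// mul1r cospi sinpi.
by apply/eqP; rewrite eq_complex/= oppr0 !eqxx.
Qed.

Lemma modulus_turn t : modulus (turn t) = 1.
Proof. by rewrite /modulus/= cos2Dsin2 sqrtr1. Qed.

Lemma turn_neq0 t : turn t != 0.
Proof. by rewrite -modulus_gt0 modulus_turn. Qed.

Lemma turnN t : turn (- t) = (turn t)^-1.
Proof.
by apply: (mulfI (turn_neq0 t)); rewrite -turnD subrr turn0 divff// turn_neq0.
Qed.

Lemma lipschitz_of_derive (f df : R -> R) :
  (forall x, is_derive x 1 f (df x)) -> (forall x, `|df x| <= 1) ->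
  forall x y, `|f x - f y| <= `|x - y|.
Proof.
move=> fd df1.
suff H x y : x <= y -> `|f x - f y| <= `|x - y|.
  move=> x y; case: (leP x y) => [|/ltW] xy; first exact: H.
  by rewrite distrC [leRHS]distrC H.
move=> xy; rewrite distrC [leRHS]distrC.
have fc : {within `[x, y], continuous f}.
  apply: derivable_within_continuous => z _.
  exact: (@ex_derive _ _ _ _ _ _ _ (fd z)).
have [u _ ->] := MVT_segment xy (fun v _ => fd v) fc.
by rewrite normrM ler_piMl.
Qed.

Lemma lipschitz_cos x y : `|cos x - cos y| <= `|x - y|.
Proof.
apply: (@lipschitz_of_derive _ (fun x => - sin x)) => u.
by rewrite normrN ler_norml sin_geN1 sin_le1.
Qed.

Lemma lipschitz_sin x y : `|sin x - sin y| <= `|x - y|.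
Proof.
apply: (@lipschitz_of_derive _ cos) => u.
by rewrite ler_norml cos_geN1 cos_le1.
Qed.

Lemma turn_lipschitz s t : modulus (turn s - turn t) <= 4 * pi * `|s - t|.
Proof.
rewrite (le_trans (modulus_ReIm _))//=.
have E : `|2 * pi * s - 2 * pi * t| = 2 * pi * `|s - t|.
  by rewrite -mulrBr normrM gtr0_norm// mulr_gt0// pi_gt0.
have := lipschitz_cos (2 * pi * s) (2 * pi * t).
have := lipschitz_sin (2 * pi * s) (2 * pi * t).
by rewrite E; lra.
Qed.

(** This Riemann sum stands for the normalized integral over the circle. *)
Definition circle_mean n (f : C -> C) : C :=
  (2 ^ n)%:R^-1 * \sum_(k < 2 ^ n) f (turn (k%:R / (2 ^ n)%:R)).

Lemma circle_mean_le n (f : C -> C) (M : R) :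
  (forall z, modulus z = 1 -> modulus (f z) <= M) ->
  modulus (circle_mean n f) <= M.
Proof.
move=> fM; rewrite /circle_mean modulusM modulusV.
have N0 : (0 < (2 ^ n)%:R :> R) by rewrite ltr0n expn_gt0.
rewrite modulus_nat mulrC ler_pdivrMr// (le_trans (modulus_sum _ _ _))//.
rewrite (@le_trans _ _ (\sum_(k < 2 ^ n) M))//; last first.
  by rewrite sumr_const card_ord mulr_natr.
by apply: ler_sum => k _; rewrite fM// modulus_turn.
Qed.

Lemma circle_meanD n (f g : C -> C) :
  circle_mean n (fun z => f z + g z) = circle_mean n f + circle_mean n g.
Proof. by rewrite /circle_mean big_split mulrDr. Qed.

Lemma circle_meanZ n (c : C) (f : C -> C) :
  circle_mean n (fun z => c * f z) = c * circle_mean n f.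
Proof. by rewrite /circle_mean -mulr_sumr mulrCA. Qed.

Lemma circle_mean_cst n (c : C) : circle_mean n (fun=> c) = c.
Proof.
by rewrite /circle_mean sumr_const card_ord -[c *+ _]mulr_natl mulrA mulVf ?mul1r.
Qed.

Lemma eq_circle_mean n (f g : C -> C) :
  (forall z, modulus z = 1 -> f z = g z) -> circle_mean n f = circle_mean n g.
Proof.
move=> fg; rewrite /circle_mean; congr (_ * _).
by apply: eq_bigr => k _; rewrite fg// modulus_turn.
Qed.

(** On an inscribed regular polygon all the edge vectors are rotations of each
    other, so the trapezoid sum is exactly a multiple of a mean. *)
Lemma curve_sum_circle K c r n :
  curve_sum K (fun t => c + r%:C * turn t) (2 ^ n) 0 1 =
  (2 ^ n)%:R * (turn (2 ^ n)%:R^-1 - (turn (2 ^ n)%:R^-1)^-1) *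
  circle_mean n (fun z => K (c + r%:C * z) * (r%:C * z)).
Proof.
rewrite /circle_mean; set N := (2 ^ n)%N; set om := turn N%:R^-1.
have N0 : (N%:R != 0 :> R) by rewrite pnatr_eq0 -lt0n expn_gt0.
have NC0 : (N%:R != 0 :> C) by rewrite pnatr_eq0 -lt0n expn_gt0.
have turnS k : turn (k.+1%:R / N%:R) = turn (k%:R / N%:R) * om.
  by rewrite -turnD -natr1 mulrDl mul1r.
pose a k := K (c + r%:C * turn (k%:R / N%:R)) * (r%:C * turn (k%:R / N%:R)).
have -> : N%:R * (om - om^-1) *
  (N%:R^-1 * \sum_(k < N) K (c + r%:C * turn (k%:R / N%:R)) *
       (r%:C * turn (k%:R / N%:R))) =
  (om - 1) * (\sum_(k < N) a k) + (1 - om^-1) * (\sum_(k < N) a k).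
  by rewrite /a; field; rewrite NC0 turn_neq0.
have {2}-> : \sum_(k < N) a k = \sum_(k < N) a k.+1.
  apply/eqP; rewrite -subr_eq0 -opprB oppr_eq0 -sumrB.
  rewrite -(big_mkord xpredT (fun k => a k.+1 - a k)) telescope_sumr//.
  by rewrite /a mul0r divff// turn0 turn1 subrr.
rewrite /curve_sum !mulr_sumr -big_split/=; apply: eq_bigr => k _.
rewrite !add0r !mul1r /trapezoid /a !turnS.
by field; rewrite turn_neq0.
Qed.

(** The factor of [curve_sum_circle] stays away from 0: the edge vectors
    om ^+ (2 k) * (om ^+ 2 - 1) lead from 1 to -1. *)
Lemma polygon_perimeter n : (1 < n)%N ->
  1 <= modulus ((2 ^ n)%:R * (turn (2 ^ n)%:R^-1 - (turn (2 ^ n)%:R^-1)^-1) : C).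
Proof.
case: n => [//|[//|n]] _; set om := turn _.
have E : om - om^-1 = (om ^+ 2 - 1) / om by field; rewrite turn_neq0.
rewrite modulusM modulus_nat E modulusM modulusV modulus_turn invr1 mulr1.
have H k : modulus (om ^+ (2 * k) - 1) <= k%:R * modulus (om ^+ 2 - 1).
  elim: k => [|k IH]; first by rewrite muln0 expr0 subrr modulus0 mul0r.
  have -> : om ^+ (2 * k.+1) - 1 =
      om ^+ (2 * k) * (om ^+ 2 - 1) + (om ^+ (2 * k) - 1).
    by rewrite mulnS exprD; ring.
  rewrite (le_trans (modulusD _ _))// modulusM modulusX modulus_turn expr1n.
  by rewrite mul1r -natr1 mulrDl mul1r addrC lerD2r.
have turnX k : om ^+ k = turn (k%:R / (2 ^ n.+2)%:R).
  elim: k => [|k IH]; first by rewrite mul0r turn0.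
  by rewrite exprSr IH -turnD -natr1 mulrDl mul1r.
have := H (2 ^ n)%N; rewrite turnX.
have -> : (2 * 2 ^ n)%:R / (2 ^ n.+2)%:R = 2^-1 :> R.
  rewrite !expnS !natrM; field.
  by rewrite pnatr_eq0 -lt0n expn_gt0.
rewrite turn_half -opprD modulusN -[1 + 1 : C]/(2%:R) modulus_nat => {}H.
rewrite (@le_trans _ _ 2)// ?ler1n// (le_trans H)//.
rewrite ler_wpM2r ?modulus_ge0// ler_nat !expnS.
by rewrite mulnA leq_pmull.
Qed.

(** [goursat] for the square mapped onto the segments that join corresponding
    points of the two circles: the sides t = 0 and t = 1 have the same image and
    cancel, and the other two give the means by [curve_sum_circle]. *)
Lemma circle_deformation K c e r : 0 <= e -> 0 <= r ->
  (forall s z, 0 <= s <= 1 -> modulus z = 1 ->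
     differentiable K ((1 - s)%:C * c + ((1 - s) * e + s * r)%:C * z)) ->
  forall eta : R, 0 < eta -> exists n0 : nat, forall n, (n0 <= n)%N ->
    modulus (circle_mean n (fun z => K (r%:C * z) * (r%:C * z)) -
             circle_mean n (fun z => K (c + e%:C * z) * (e%:C * z))) <= eta.
Proof.
move=> e0 r0 dK eta eta0.
pose P s t := (1 - s)%:C * c + ((1 - s) * e + s * r)%:C * turn t.
pose L := modulus c + e + r + (e + r) * (4 * pi).
have pi0 : 0 < pi :> R := pi_gt0 R.
have c0 := modulus_ge0 c.
have er0 : 0 <= (e + r) * (4 * pi) by apply: mulr_ge0; lra.
have L0 : 0 <= L by rewrite /L; lra.
have [||n0 H] := @goursat _ K P L L0 _ _ eta eta0.
- move=> s t s' t' s1 _ s'1 _.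
  have -> : P s t - P s' t' =
     (s - s')%:C * (- c + (r - e)%:C * turn t) +
     ((1 - s') * e + s' * r)%:C * (turn t - turn t').
    by rewrite /P; rewrite !(rmorphD, rmorphB, rmorphM, rmorph1); ring.
  rewrite (le_trans (modulusD _ _))// !modulusM !modulus_real.
  have H1 : modulus (- c + (r - e)%:C * turn t) <= modulus c + e + r.
    rewrite (le_trans (modulusD _ _))// modulusN modulusM modulus_turn.
    rewrite modulus_real mulr1 -addrA lerD2l ler_norml; lra.
  have H2 := turn_lipschitz t t'.
  have H3 : 0 <= (1 - s') * e + s' * r by rewrite addr_ge0// mulr_ge0//; lra.
  have H4 : (1 - s') * e + s' * r <= e + r by nra.
  rewrite (ger0_norm H3) /L mulrDr; apply: lerD.
    by rewrite mulrC ler_wpM2r// (le_trans H1)//; lra.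
  rewrite (@le_trans _ _ ((e + r) * (4 * pi * `|t - t'|)))//.
    by apply: ler_pM => //; exact: modulus_ge0.
  by rewrite mulrA ler_wpM2r//; lra.
- by move=> s t s1 _; apply: dK => //; exact: modulus_turn.
exists (maxn n0 2) => n; rewrite geq_max => /andP[/H{}H n2].
apply: le_trans H.
have -> : square_sum K P (2 ^ n) 0 0 1 =
    curve_sum K (fun t => 0 + r%:C * turn t) (2 ^ n) 0 1 -
    curve_sum K (fun t => c + e%:C * turn t) (2 ^ n) 0 1.
  rewrite /square_sum add0r.
  have -> : P^~ 1 = P^~ 0 by apply/funext => s; rewrite /P turn1 turn0.
  have -> : P 1 = (fun t => 0 + r%:C * turn t).
    by apply/funext => t; rewrite /P subrr !mul0r !add0r mul1r.
  have -> : P 0 = (fun t => c + e%:C * turn t).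
    by apply/funext => t; rewrite /P subr0 mul0r addr0 !mul1r.
  by ring.
rewrite !curve_sum_circle.
have -> : circle_mean n (fun z => K (0 + r%:C * z) * (r%:C * z)) =
    circle_mean n (fun z => K (r%:C * z) * (r%:C * z)).
  by apply: eq_circle_mean => z _; rewrite add0r.
have := polygon_perimeter n2; set A := _ * (_ - _) => A1.
by rewrite -[A * _ - A * _]mulrBr [leRHS]modulusM ler_peMl ?modulus_ge0.
Qed.

(** Cauchy's formula, obtained by shrinking the circle to the point: the
    interpolating circles avoid it because it lies inside the large one. *)
Lemma cauchy_formula G r z0 : modulus z0 < r ->
  (forall z, modulus z <= r -> differentiable G z) ->
  forall eta : R, 0 < eta -> exists n0 : nat, forall n, (n0 <= n)%N ->
    modulus (circle_mean n (fun z => G (r%:C * z) * (r%:C * z / (r%:C * z - z0)))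
             - G z0) <= eta.
Proof.
move=> z0r dG eta eta0.
have r0 : 0 < r by rewrite (le_lt_trans (modulus_ge0 z0)).
have eta2 : 0 < eta / 2 by lra.
have [d d0 Gd] := differentiable_cont_modulus (dG z0 (ltW z0r)) eta2.
pose e := Num.min (d / 2) ((r - modulus z0) / 2).
have e0 : 0 < e by rewrite lt_min; apply/andP; split; lra.
have ed : e < d by rewrite gt_min; apply/orP; left; lra.
have er : e < r - modulus z0 by rewrite gt_min; apply/orP; right; lra.
pose K z := G z / (z - z0).
have [|n0 H] := @circle_deformation K z0 e r (ltW e0) (ltW r0) _ _ eta2.
  move=> s z s1 z1; set p := _ + _.
  have z00 := modulus_ge0 z0.
  have rho0 : 0 < (1 - s) * e + s * r by nra.
  have pr : modulus p <= r.
    rewrite (le_trans (modulusD _ _))// !modulusM z1 !modulus_real.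
    rewrite (gtr0_norm rho0) ger0_norm; last by lra.
    by nra.
  have pz : p - z0 != 0.
    rewrite -modulus_gt0.
    have -> : p - z0 = ((1 - s) * e + s * r)%:C * z - s%:C * z0.
      by rewrite /p !(rmorphD, rmorphB, rmorphM, rmorph1); ring.
    rewrite (lt_le_trans _ (modulus_dist _ _))// !modulusM z1 !modulus_real.
    rewrite (gtr0_norm rho0) ger0_norm; last by lra.
    have [->|s0] := eqVneq s 0; first by lra.
    by have : 0 < s by [lra]; nra.
  apply: differentiableM; first exact: dG.
  by apply: differentiableV => //; apply: differentiableB.
exists n0 => n /H{}H.
rewrite -[G z0](circle_mean_cst n).
set A := circle_mean _ _; set B := circle_mean _ _.
have {}H : modulus (A - circle_mean n (fun z => G (z0 + e%:C * z))) <= eta / 2.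
  move: H; congr (modulus (_ - _) <= _); apply: eq_circle_mean => z z1.
    by rewrite /K mulrA; ring.
  have z0' : z != 0 by rewrite -modulus_gt0 z1.
  have e0' : e%:C != 0 by rewrite -modulus_gt0 modulus_real gtr0_norm.
  by rewrite /K addrAC subrr add0r divfK// mulf_neq0.
have H2 : modulus (circle_mean n (fun z => G (z0 + e%:C * z)) - B) <= eta / 2.
  rewrite -mulN1r -circle_meanZ -circle_meanD; apply: circle_mean_le => z z1.
  rewrite mulN1r; apply: Gd; rewrite addrAC subrr add0r modulusM z1 mulr1.
  by rewrite modulus_real gtr0_norm.
rewrite (_ : A - B = (A - circle_mean n (fun z => G (z0 + e%:C * z))) +
  (circle_mean n (fun z => G (z0 + e%:C * z)) - B)); last by ring.
by rewrite (le_trans (modulusD _ _))//; lra.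
Qed.

End Circle.

(** * Bounded holomorphic functions on the disc *)

Section Disc.
Variable R : realType.
Notation C := R[i].
Implicit Types (G H : C -> C) (z w c : C) (r e t M : R) (n m : nat).

Lemma le_of_expr_le (g M Q : R) : 0 <= M ->
  (forall m, g ^+ m <= Q * M ^+ m) -> g <= M.
Proof.
move=> M0 gM; rewrite leNgt; apply/negP => Mg.
have [M00|Mn0] := eqVneq M 0; first by have := gM 1%N; rewrite M00; lra.
have {}M0 : 0 < M by rewrite lt_neqAle eq_sym Mn0.
pose x := g / M - 1.
have x0 : 0 < x by rewrite subr_gt0 ltr_pdivlMr// mul1r.
have bern m : 1 + m%:R * x <= (1 + x) ^+ m.
  elim: m => [|m IH]; first by rewrite expr0 mul0r addr0.
  rewrite exprSr -natr1; have mx : 0 <= m%:R * x by rewrite mulr_ge0// ltW.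
  have := ler_wpM2r (ltW (ltr_pwDl ltr01 (ltW x0))) IH.
  by nra.
have qQ m : (1 + x) ^+ m <= Q.
  by rewrite addrC subrK expr_div_n ler_pdivrMr ?exprn_gt0.
pose m := Num.bound (Q / x).
have Qm : Q / x < m%:R.
  apply: archi_boundP; apply: divr_ge0 (ltW x0).
  by apply: le_trans (qQ 0%N); rewrite expr0.
have := bern m; have := qQ m; move: Qm; rewrite ltr_pdivrMr//; lra.
Qed.

Lemma le_of_scaled_le (a h M : R) : a < 1 ->
  (forall t, a < t < 1 -> t * h <= M) -> h <= M.
Proof.
move=> a1 hM; rewrite leNgt; apply/negP => Mh.
pose d := h - M; pose k := `|h| + 1.
have k0 : 0 < k by rewrite ltr_wpDl.
pose s := Num.min ((1 - a) / 2) (d / (2 * k)).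
have d0 : 0 < d by rewrite subr_gt0.
have s0 : 0 < s by rewrite lt_min divr_gt0 ?subr_gt0// divr_gt0// mulr_gt0.
have sa : s <= (1 - a) / 2 by rewrite ge_min lexx.
have sd : s * k <= d / 2.
  have : s <= d / (2 * k) by rewrite ge_min lexx orbT.
  rewrite ler_pdivlMr ?mulr_gt0//; lra.
have H1 : (1 - s) * h <= M by apply: hM; lra.
have H2 : s * h <= s * k by rewrite ler_pM2l// /k; have := ler_norm h; lra.
by rewrite /d in d0 sd; lra.
Qed.

Lemma le_of_all_addgt0 (x y : R) :
  (forall e, 0 < e -> x <= y + e) -> x <= y.
Proof. by move=> H; apply/ler_addgt0Pr. Qed.

(** Applying Cauchy's formula to the powers of [G] removes the constant that
    the Cauchy kernel would contribute. *)
Lemma maximum_principle G r M z0 : modulus z0 < r ->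
  (forall z, modulus z <= r -> differentiable G z) ->
  (forall z, modulus z = r -> modulus (G z) <= M) -> modulus (G z0) <= M.
Proof.
move=> z0r dG GM.
have r0 : 0 < r by rewrite (le_lt_trans (modulus_ge0 z0)).
have M0 : 0 <= M.
  apply: le_trans (modulus_ge0 _) (GM r%:C _).
  by rewrite modulus_real gtr0_norm.
have rz0 : 0 < r - modulus z0 by rewrite subr_gt0.
apply: (@le_of_expr_le _ _ (r / (r - modulus z0))) => // m.
apply: le_of_all_addgt0 => e e0.
have dGm z : modulus z <= r -> differentiable (fun z => G z ^+ m) z.
  move=> /dG dGz; elim: m => [|m IH]; first exact: differentiable_cst.
  rewrite (_ : (fun _ => _) = fun z => G z * G z ^+ m).
    exact: differentiableM.
  by apply/funext => w; rewrite exprS.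
have [n0 /(_ n0 (leqnn _)) H] := cauchy_formula z0r dGm e0.
rewrite -modulusX.
set A := circle_mean _ _ in H.
have AM : modulus A <= r / (r - modulus z0) * M ^+ m.
  apply: circle_mean_le => z z1.
  have rz : modulus (r%:C * z) = r by rewrite modulusM z1 modulus_real mulr1 gtr0_norm.
  rewrite modulusM modulusX modulusM modulusV rz mulrC.
  apply: ler_pM; rewrite ?exprn_ge0 ?divr_ge0 ?modulus_ge0//; first exact: ltW.
    rewrite ler_pM2l// lef_pV2 ?posrE//; last first.
      by rewrite (lt_le_trans rz0)// -[r in r - _]rz modulus_dist.
    by rewrite -[r in r - _]rz modulus_dist.
  by apply: lerXn2r; rewrite ?nnegrE ?modulus_ge0 ?GM.
have := modulus_dist (G z0 ^+ m) A; rewrite modulusB; lra.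
Qed.

Lemma differentiable_local G H z (d : R) : 0 < d ->
  (forall w, modulus (w - z) < d -> G w = H w) ->
  differentiable G z -> differentiable H z.
Proof.
move=> d0 GH /differentiable_modulusP[l Gl].
apply/differentiable_modulusP; exists l => e /Gl[d' d'0 {}Gl].
exists (Num.min d d'); first by rewrite lt_min d0.
move=> w; rewrite lt_min => /andP[wd wd'].
by rewrite -!GH ?Gl// subrr modulus0.
Qed.

(** Both sequences are treated in one compactness argument so that they come
    close to their cluster points at the same indices. *)
Lemma bounded_cluster_pair (x y : nat -> C) M :
  (forall n, modulus (x n) <= M) -> (forall n, modulus (y n) <= M) ->
  exists a b, forall e, 0 < e -> forall n0, exists2 n, (n0 <= n)%N &
    modulus (x n - a) <= e /\ modulus (y n - b) <= e.
Proof.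
move=> xM yM.
pose s (i : 'I_4) n : R := nth 0 [:: complex.Re (x n); complex.Im (x n);
  complex.Re (y n); complex.Im (y n)] i.
pose u n : 'rV[R]_4 := \row_i s i n.
pose K := [set v : 'rV[R]_4 | forall i, `[- M, M]%classic (v ord0 i)].
have Kc : compact K.
  exact: (@rV_compact _ _ (fun=> `[- M, M]%classic) (fun=> @segment_compact _ _ _)).
have uK : (u @ \oo) K.
  exists 0%N => // n _ /= i; rewrite mxE /= in_itv/= -ler_norml.
  rewrite /s; case: i => -[|[|[|[|//]]]] /= _;
    by rewrite ?(le_trans (ler_Re_modulus _))// ?(le_trans (ler_Im_modulus _)).
have [p [_ pu]] := Kc _ _ uK.
exists (p ord0 (inord 0) +i* p ord0 (inord 1)).
exists (p ord0 (inord 2) +i* p ord0 (inord 3)) => e e0 n0.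
have [||_ [[n /= n0n <-] up]] := pu (u @` [set n | (n0 <= n)%N]) (ball p (e / 2)) _ _.
- by exists n0 => // n /= n0n; exists n.
- by apply: nbhsx_ballx; lra.
exists n => //.
have P (i : 'I_4) : `|s i n - p ord0 i| < e / 2.
  by have := up.2 ord0 i; rewrite /ball/= mxE distrC.
have P0 := P (inord 0); have P1 := P (inord 1).
have P2 := P (inord 2); have P3 := P (inord 3).
rewrite /s !inordK//= in P0 P1 P2 P3.
split.
  rewrite (le_trans (modulus_ReIm _))//; case: (x n) P0 P1 => a b /=; lra.
rewrite (le_trans (modulus_ReIm _))//; case: (y n) P2 P3 => a b /=; lra.
Qed.

(** Expanding the Cauchy kernel to third order and passing to cluster points of
    its coefficients. *)
Lemma second_order_expansion G r M : 0 < r ->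
  (forall z, modulus z <= r -> differentiable G z) ->
  (forall z, modulus z = r -> modulus (G z) <= M) ->
  exists b c, exists Q : R, forall z, modulus z <= r / 2 ->
    modulus (G z - G 0 - b * z - c * z ^+ 2) <= Q * modulus z ^+ 3.
Proof.
move=> r0 dG GM.
have M0 : 0 <= M.
  apply: le_trans (modulus_ge0 _) (GM r%:C _).
  by rewrite modulus_real gtr0_norm.
have rz z : modulus z = 1 -> modulus (r%:C * z) = r.
  by move=> z1; rewrite modulusM z1 modulus_real mulr1 gtr0_norm.
pose b_ n := circle_mean n (fun z => G (r%:C * z) / (r%:C * z)).
pose c_ n := circle_mean n (fun z => G (r%:C * z) / (r%:C * z) ^+ 2).
have ri0 : 0 < r^-1 by rewrite invr_gt0.
have [||b [c bc]] := @bounded_cluster_pair b_ c_ (M * r^-1 + M * r^-1 ^+ 2).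
- move=> n; apply: circle_mean_le => z z1.
  rewrite modulusM modulusV rz// (@le_trans _ _ (M * r^-1))//.
    by rewrite ler_pM2r// GM// rz.
  by rewrite lerDl mulr_ge0// exprn_ge0// ltW.
- move=> n; apply: circle_mean_le => z z1.
  rewrite modulusM modulusV modulusX rz// (@le_trans _ _ (M * r^-1 ^+ 2))//.
    by rewrite exprVn ler_pM2r ?invr_gt0 ?exprn_gt0// GM// rz.
  by rewrite lerDr mulr_ge0// ltW.
exists b, c, (M * (r^-1 ^+ 2 * (r / 2)^-1)) => z zr.
have zr' : modulus z < r by lra.
have z0r : modulus (0 : C) < r by rewrite modulus0.
apply: le_of_all_addgt0 => e e0.
pose k := 2 + modulus z + modulus z ^+ 2.
have z0 := modulus_ge0 z.
have k0 : 0 < k by rewrite /k; nra.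
have ek : 0 < e / k by rewrite divr_gt0.
have [n1 H1] := cauchy_formula zr' dG ek.
have [n2 H2] := cauchy_formula z0r dG ek.
have [n] := bc _ ek (maxn n1 n2).
rewrite geq_max => /andP[/H1{}H1 /H2{}H2] [H3 H4].
set X := circle_mean _ _ in H1; set A := circle_mean _ _ in H2.
pose D := circle_mean n (fun w => G (r%:C * w) / (r%:C * w) ^+ 2 / (r%:C * w - z)).
have XE : X = A + z * b_ n + z ^+ 2 * c_ n + z ^+ 3 * D.
  rewrite /A /b_ /c_ /D -!circle_meanZ -!circle_meanD.
  apply: eq_circle_mean => w w1.
  have w0 : r%:C * w != 0 by rewrite -modulus_gt0 rz.
  have wz : r%:C * w - z != 0.
    by rewrite subr_eq0; apply/eqP => E; move: zr'; rewrite -E rz// ltxx.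
  by move: w0 wz; set v := r%:C * w => v0 vz; field; rewrite vz v0.
have DM : modulus D <= M * (r^-1 ^+ 2 * (r / 2)^-1).
  apply: circle_mean_le => w w1; rewrite !modulusM !modulusV modulusX rz//.
  rewrite -mulrA; apply: ler_pM; rewrite ?modulus_ge0 ?GM ?rz//.
    by rewrite mulr_ge0 ?invr_ge0 ?exprn_ge0 ?modulus_ge0// ltW.
  rewrite exprVn ler_pM2l ?invr_gt0 ?exprn_gt0// lef_pV2 ?posrE.
  - by rewrite (le_trans _ (modulus_dist _ _))// rz//; lra.
  - by rewrite (lt_le_trans _ (modulus_dist _ _))// rz//; lra.
  - by lra.
have -> : G z - G 0 - b * z - c * z ^+ 2 =
  - (X - G z) + (A - G 0) + z * (b_ n - b) + z ^+ 2 * (c_ n - c) + z ^+ 3 * D.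
  by rewrite XE; ring.
have eE : e = e / k + e / k + modulus z * (e / k) + modulus z ^+ 2 * (e / k).
  by rewrite /k; field; rewrite gt_eqF.
set q := M * _ in DM *.
have -> : q * modulus z ^+ 3 + e = e / k + e / k + modulus z * (e / k) +
  modulus z ^+ 2 * (e / k) + modulus z ^+ 3 * q by rewrite {1}eE; ring.
apply: le_trans (modulusD _ _) _; apply: lerD; last first.
  by rewrite modulusM modulusX ler_wpM2l// exprn_ge0.
apply: le_trans (modulusD _ _) _; apply: lerD; last first.
  by rewrite modulusM modulusX ler_wpM2l// exprn_ge0.
apply: le_trans (modulusD _ _) _; apply: lerD; last first.
  by rewrite modulusM ler_wpM2l.
by apply: le_trans (modulusD _ _) _; apply: lerD => //; rewrite modulusN.
Qed.

(** Division by the coordinate: the singularity at the origin is removable. *)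
Lemma divided_difference G r M : 0 < r ->
  (forall z, modulus z <= r -> differentiable G z) ->
  (forall z, modulus z = r -> modulus (G z) <= M) ->
  exists H, [/\ forall z, G z = G 0 + z * H z, differentiable H 0 &
    forall z, z != 0 -> differentiable G z -> differentiable H z].
Proof.
move=> r0 dG GM.
have [b [c [Q bc]]] := second_order_expansion r0 dG GM.
pose H z := if z == 0 then b else (G z - G 0) / z.
exists H; split=> [z||z z0 dGz].
- rewrite /H; case: eqVneq => [->|z0]; first by rewrite mul0r addr0.
  by rewrite mulrC divfK// addrC subrK.
- apply/differentiable_modulusP; exists c => e e0.
  have Q0 : 0 < `|Q| + 1 by rewrite ltr_wpDl.
  exists (Num.min (r / 2) (e / (`|Q| + 1))).
    by rewrite lt_min !divr_gt0.
  move=> w; rewrite subr0 lt_min => /andP[wr we].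
  rewrite /H eqxx; case: eqVneq => [->|w0].
    by rewrite mulr0 !subrr modulus0 mulr0.
  rewrite -(@ler_pM2r _ (modulus w)) ?modulus_gt0// -modulusM.
  rewrite (_ : _ * w = G w - G 0 - b * w - c * w ^+ 2); last by field.
  rewrite (le_trans (bc _ (ltW wr)))//.
  have w00 := modulus_ge0 w.
  have QQ : Q * modulus w <= e.
    move: we; rewrite ltr_pdivlMr// => we.
    have := ler_norm Q; nra.
  rewrite (_ : Q * _ = Q * modulus w * (modulus w * modulus w)); last by ring.
  by rewrite -[leRHS]mulrA ler_wpM2r// mulr_ge0.
- apply: (@differentiable_local (fun w => (G w - G 0) / w) _ _ (modulus z)).
  + by rewrite modulus_gt0.
  + move=> w wz; rewrite /H; case: eqVneq => // w0.
    by move: wz; rewrite w0 sub0r modulusN ltxx.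
  + apply: differentiableM; first exact: differentiableB.
    by apply: differentiableV.
Qed.

Definition bounded_holomorphic M G :=
  (forall z, modulus z < 1 -> differentiable G z) /\
  (forall z, modulus z < 1 -> modulus (G z) <= M).

(** On the circle of radius t the quotient is at most M / t, and t tends to 1. *)
Lemma schwarz G M : bounded_holomorphic M G -> G 0 = 0 ->
  exists H, bounded_holomorphic M H /\ forall z, G z = z * H z.
Proof.
move=> [dG GM] G0.
have r0 : 0 < 2^-1 :> R by lra.
have [|||H [GH dH0 dH]] := @divided_difference G 2^-1 M.
- by [].
- by move=> z z2; apply: dG; lra.
- by move=> z z2; apply: GM; lra.
exists H; split; last by move=> z; rewrite GH G0 add0r.
have HD z : modulus z < 1 -> differentiable H z.
  by have [->//|z0] := eqVneq z 0; move=> /dG; exact: dH.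
split=> // z z1.
apply: (le_of_scaled_le z1) => t /andP[zt t1].
have t0 : 0 < t by rewrite (le_lt_trans (modulus_ge0 z)).
rewrite mulrC -ler_pdivlMr//.
apply: (maximum_principle zt) => w wt.
  by apply: HD; exact: le_lt_trans t1.
rewrite ler_pdivlMr// -wt mulrC -modulusM.
by have := GM w; rewrite GH G0 add0r wt; exact.
Qed.

Lemma schwarz_le G M : bounded_holomorphic M G -> G 0 = 0 ->
  forall z, modulus z < 1 -> modulus (G z) <= M * modulus z.
Proof.
move=> GM G0 z z1; have [H [[_ HM] ->]] := schwarz GM G0.
by rewrite modulusM mulrC ler_wpM2r ?modulus_ge0 ?HM.
Qed.

Lemma pseudo_hyperbolic_le z w : modulus z <= 1 -> modulus w <= 1 ->
  modulus (z - w) <= modulus (1 - w^*%C * z).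
Proof.
move=> z1 w1; rewrite -(ler_pXn2r (n := 2)) ?nnegrE ?modulus_ge0//.
have zz : modulus z ^+ 2 <= 1 by rewrite expr_le1// modulus_ge0.
have ww : modulus w ^+ 2 <= 1 by rewrite expr_le1// modulus_ge0.
move: zz ww; rewrite !modulus_sqr.
case: z z1 => a b z1; case: w w1 => c d w1 /=.
move=> zz ww; rewrite -subr_ge0.
rewrite (_ : _ - _ = (1 - (a ^+ 2 + b ^+ 2)) * (1 - (c ^+ 2 + d ^+ 2))).
  by rewrite mulr_ge0 ?subr_ge0.
by ring.
Qed.

(** Schwarz-Pick from the centre. When the value there is unimodular, the
    strict case applies to t G for t < 1 and forces G to be constant. *)
Lemma schwarz_pick G z : bounded_holomorphic 1 G -> modulus z < 1 ->
  modulus (G z - G 0) <= modulus z * modulus (1 - (G 0)^*%C * G z).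
Proof.
have strict (F : C -> C) : bounded_holomorphic 1 F -> modulus (F 0) < 1 ->
    modulus z < 1 ->
    modulus (F z - F 0) <= modulus z * modulus (1 - (F 0)^*%C * F z).
  move=> [dF F1] F0 z1.
  pose q w := 1 - (F 0)^*%C * F w.
  have q0 w : modulus w < 1 -> q w != 0.
    move=> w1; rewrite -modulus_gt0 (lt_le_trans _ (modulus_dist _ _))//.
    rewrite modulus1 modulusM modulus_conj subr_gt0.
    have := F1 _ w1; have := modulus_ge0 (F w); have := modulus_ge0 (F 0); nra.
  have := @schwarz_le (fun w => (F w - F 0) / q w) 1 _ _ z z1.
  rewrite modulusM modulusV ler_pdivrMr ?modulus_gt0 ?q0// mul1r; apply.
    split=> w w1.
      apply: differentiableM.
        by apply: differentiableB; [exact: dF|exact: differentiable_cst].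
      apply: differentiableV; last exact: q0.
      apply: differentiableB; first exact: differentiable_cst.
      by apply: differentiableM; [exact: differentiable_cst|exact: dF].
    rewrite modulusM modulusV ler_pdivrMr ?modulus_gt0 ?q0// mul1r.
    by apply: pseudo_hyperbolic_le; apply: F1; rewrite ?modulus0.
  by rewrite subrr mul0r.
move=> GB z1; have [dG G1] := GB.
have o1 : modulus (0 : C) < 1 by rewrite modulus0.
have [|G01] := ltP (modulus (G 0)) 1; first by move=> ?; exact: strict.
have {}G01 : modulus (G 0) = 1 by apply/eqP; rewrite eq_le G01 G1.
have dE : modulus (1 - (G 0)^*%C * G z) = modulus (G z - G 0).
  rewrite -[RHS]mul1r -G01 -(modulus_conj (G 0)) -modulusM mulrBr.
  rewrite [_^*%C * G 0]mulrC -sqr_normc modulusE G01 expr1n.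
  by rewrite -modulusN opprB.
rewrite dE; set d := modulus _.
have d0 : 0 <= d := modulus_ge0 _.
have z0 := modulus_ge0 z.
rewrite leNgt; apply/negP => zd.
pose x := d - modulus z * d; have x0 : 0 < x by rewrite subr_gt0.
have d2 : 0 < 2 * (d + 2) by lra.
pose s := x / (2 * (d + 2)).
have sE : s * (2 * (d + 2)) = x by rewrite divfK// gt_eqF.
have s0 : 0 < s by rewrite divr_gt0.
have s1 : s < 1 by rewrite ltr_pdivrMr// /x; nra.
have t1 : `|1 - s| = 1 - s by rewrite ger0_norm//; lra.
have sGB : bounded_holomorphic 1 (fun w => (1 - s)%:C * G w).
  split=> w w1; first by apply: differentiableM => //; exact: dG.
  rewrite modulusM modulus_real t1; have := G1 _ w1; have := modulus_ge0 (G w).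
  by nra.
have sG0 : modulus ((1 - s)%:C * G 0) < 1.
  by rewrite modulusM modulus_real t1 G01; lra.
have := strict _ sGB sG0 z1; apply/negP; rewrite -ltNge.
rewrite -mulrBr modulusM modulus_real t1 -/d.
have H : modulus (1 - ((1 - s)%:C * G 0)^*%C * ((1 - s)%:C * G z)) <= d + 2 * s.
  have -> : ((1 - s)%:C * G 0)^*%C = (1 - s)%:C * (G 0)^*%C.
    by rewrite rmorphM; congr (_ * _); apply/eqP; rewrite eq_complex/= oppr0 !eqxx.
  rewrite (_ : 1 - _ = (1 - (G 0)^*%C * G z) +
     (s * (2 - s))%:C * ((G 0)^*%C * G z)); last first.
    by rewrite !(rmorphM, rmorphB, rmorph1, rmorph_nat)/=; ring.
  rewrite (le_trans (modulusD _ _))// dE lerD2l !modulusM modulus_conj G01 mul1r.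
  rewrite modulus_real ger0_norm; last by nra.
  have := G1 _ z1; have := modulus_ge0 (G z); nra.
have {}H := ler_wpM2l z0 H.
rewrite (le_lt_trans H)//; rewrite /x in sE; nra.
Qed.

(** When G z0 is unimodular, |1 - conj (G 0) G z0| equals |G z0 - G 0|, so the
    factor |z0| < 1 in [schwarz_pick] forces G 0 = G z0; with G 0 unimodular the
    same cancellation occurs at every point. *)
Lemma bounded_holomorphic_rigid G z0 : bounded_holomorphic 1 G ->
  modulus z0 < 1 -> modulus (G z0) = 1 -> forall z, modulus z < 1 -> G z = G z0.
Proof.
move=> GB z01 Gz0.
have unimod u v : modulus u = 1 -> modulus (1 - v^*%C * u) = modulus (u - v).
  move=> u1; rewrite -[RHS]modulus_conj -[RHS]mul1r -u1 -modulusM rmorphB mulrBr.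
  by rewrite -sqr_normc modulusE u1 expr1n mulrC.
have H0 : G z0 = G 0.
  have := schwarz_pick GB z01; rewrite unimod//.
  have := modulus_ge0 (G z0 - G 0); have := modulus_ge0 z0 => ? ? ?.
  apply/eqP; rewrite -subr_eq0; apply/eqP/modulus_eq0; nra.
move=> z z1; rewrite H0.
have := schwarz_pick GB z1.
have -> : modulus (1 - (G 0)^*%C * G z) = modulus (G z - G 0).
  have sym u v : modulus (1 - v^*%C * u) = modulus (1 - u^*%C * v).
    by case: u v => a b [c d]; congr (Num.sqrt _); rewrite /=; ring.
  by rewrite sym unimod -?H0// modulusB.
have := modulus_ge0 (G z - G 0); have := modulus_ge0 z => ? ? ?.
apply/eqP; rewrite -subr_eq0; apply/eqP/modulus_eq0; nra.
Qed.

Lemma eq0_of_linear_bound H (d Q : R) : differentiable H 0 -> 0 < d ->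
  (forall z, z != 0 -> modulus z < d -> modulus (H z) <= Q * modulus z) ->
  H 0 = 0.
Proof.
move=> dH d0 HQ; apply: modulus_eq0; apply/eqP; rewrite eq_le modulus_ge0 andbT.
apply: le_of_all_addgt0 => e e0; rewrite add0r.
have e2 : 0 < e / 2 by lra.
have [d' d'0 He] := differentiable_cont_modulus dH e2.
have Q0 : 0 < 2 * (`|Q| + 1) by rewrite mulr_gt0// ltr_wpDl.
pose x := Num.min (Num.min d d') (e / (2 * (`|Q| + 1))) / 2.
have m0 : 0 < Num.min (Num.min d d') (e / (2 * (`|Q| + 1))).
  by rewrite !lt_min d0 d'0 divr_gt0.
have x0 : 0 < x by rewrite divr_gt0.
have xm : x < Num.min (Num.min d d') (e / (2 * (`|Q| + 1))) by rewrite /x; lra.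
move: xm; rewrite !lt_min => /andP[/andP[xd xd'] xe].
have mx : modulus x%:C = x by rewrite modulus_real gtr0_norm.
have := He x%:C; rewrite subr0 mx => /(_ xd').
have := HQ x%:C; rewrite -modulus_gt0 mx => /(_ x0 xd).
have := modulus_dist (H 0) (H x%:C); rewrite modulusB.
move: xe; rewrite ltr_pdivlMr// => xe.
have := ler_norm Q; nra.
Qed.

Lemma schwarz_double_zero G M (d Q : R) : bounded_holomorphic M G -> 0 < d ->
  (forall z, modulus z < d -> modulus (G z) <= Q * modulus z ^+ 2) ->
  exists H, bounded_holomorphic M H /\ forall z, G z = z ^+ 2 * H z.
Proof.
move=> GB d0 GQ.
have G0 : G 0 = 0.
  apply: modulus_eq0; apply/eqP; rewrite eq_le modulus_ge0 andbT.
  by rewrite (le_trans (GQ _ _)) ?modulus0// expr0n mulr0.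
have [H [HB GH]] := schwarz GB G0.
have H0 : H 0 = 0.
  apply: (@eq0_of_linear_bound _ d Q) => //.
    by apply: HB.1; rewrite modulus0.
  move=> z z0 /GQ; rewrite GH modulusM expr2 mulrCA ler_pM2l ?modulus_gt0//.
have [K [KB HK]] := schwarz HB H0.
by exists K; split=> // z; rewrite GH HK mulrA expr2.
Qed.

(** Dividing by the coordinate, two interior points are fixed by a self-map of
    the disc; Schwarz-Pick at both puts its value at the origin at 0. *)
Lemma square_of_three_points G (p : R) : bounded_holomorphic 1 G -> 0 < p < 1 ->
  G 0 = 0 -> G p%:C = (p ^+ 2)%:C -> G (- p%:C) = (p ^+ 2)%:C ->
  forall z, modulus z < 1 -> G z = z ^+ 2.
Proof.
move=> GB /andP[p0 p1] G0 Gp GNp.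
have [H [HB GH]] := schwarz GB G0.
have mp : modulus p%:C = p by rewrite modulus_real gtr0_norm.
have pC0 : p%:C != 0 by rewrite -modulus_gt0 mp.
have Hp : H p%:C = p%:C.
  by apply: (mulfI pC0); rewrite -GH Gp expr2 rmorphM.
have HNp : H (- p%:C) = - p%:C.
  apply: (mulfI pC0); apply: oppr_inj; rewrite -mulNr -GH GNp mulrN opprK.
  by rewrite expr2 rmorphM.
have H0 : H 0 = 0.
  have := schwarz_pick HB (_ : modulus p%:C < 1).
  have := schwarz_pick HB (_ : modulus (- p%:C) < 1).
  rewrite modulusN Hp HNp mp => /(_ p1) I1 /(_ p1) I2.
  have sqr_le (u v : C) : modulus u <= p * modulus v ->
      modulus u ^+ 2 <= p ^+ 2 * modulus v ^+ 2.
    by move=> uv; rewrite -exprMn lerXn2r ?nnegrE ?mulr_ge0 ?modulus_ge0// ltW.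
  apply/eqP/negPn/negP; move: (sqr_le _ _ I1) (sqr_le _ _ I2).
  rewrite !modulus_sqr; case: (H 0) => x y /= J1 J2 xy0.
  have xy : 0 < x ^+ 2 + y ^+ 2.
    rewrite lt_neqAle addr_ge0 ?sqr_ge0// andbT eq_sym paddr_eq0 ?sqr_ge0//.
    by rewrite !sqrf_eq0; move: xy0; rewrite eq_complex.
  have p4 : p ^+ 4 < 1 by rewrite expr_lt1// ltW.
  have : (1 - p ^+ 4) * (x ^+ 2 + y ^+ 2) <= 0 by lra.
  by apply/negP; rewrite -ltNge mulr_gt0// subr_gt0.
have [K [KB HK]] := schwarz HB H0.
have Kp : K p%:C = 1 by apply: (mulfI pC0); rewrite -HK Hp mulr1.
move=> z z1; rewrite GH HK.
have := bounded_holomorphic_rigid KB (_ : modulus p%:C < 1).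
by rewrite mp Kp modulus1 => /(_ p1 erefl) ->//; rewrite mulr1 expr2.
Qed.

(** Dividing by the coordinate m times gives |G z| <= M |z|^m for every m. *)
Lemma bounded_holomorphic_eq0 G M (d : R) : bounded_holomorphic M G -> 0 < d ->
  (forall z, modulus z < d -> G z = 0) ->
  forall z, modulus z < 1 -> G z = 0.
Proof.
move=> GB d0 Gd z z1.
have H m : forall F, bounded_holomorphic M F ->
    (forall z, modulus z < d -> F z = 0) -> modulus (F z) <= M * modulus z ^+ m.
  elim: m => [|m IH] F FB Fd; first by rewrite expr0 mulr1; apply: FB.2.
  have F0 : F 0 = 0 by apply: Fd; rewrite modulus0.
  have [K [KB FK]] := schwarz FB F0.
  rewrite FK modulusM exprS mulrCA ler_wpM2l ?modulus_ge0// IH// => w wd.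
  have Kw v : v != 0 -> modulus v < d -> K v = 0.
    by move=> v0 /Fd/eqP; rewrite FK mulf_eq0 (negPf v0)/= => /eqP.
  have [->|/Kw] := eqVneq w 0; last exact.
  apply: (@eq0_of_linear_bound _ d 0) => //.
    by apply: KB.1; rewrite modulus0.
  by move=> v v0 vd; rewrite Kw// modulus0 mul0r.
have [Gz|Gz] := eqVneq (G z) 0; first by [].
have g0 : 0 < modulus (G z) by rewrite modulus_gt0.
suff : 1 <= modulus z by rewrite leNgt z1.
apply: (@le_of_expr_le _ _ (M / modulus (G z))); first exact: modulus_ge0.
move=> m; rewrite expr1n mulrAC ler_pdivlMr// mul1r; exact: H.
Qed.

End Disc.

(** * Bounded holomorphic functions on the ball of C^2 *)

Section Ball.
Variable R : realType.
Notation C := R[i].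
Implicit Types (F f : C -> C -> C) (p q : C -> C) (a b x y z w : C).

Definition quadratic p :=
  exists u v w : C, forall z, p z = u + v * z + w * z ^+ 2.

Lemma quadratic_cst u : quadratic (fun=> u).
Proof. by exists u, 0, 0 => z; ring. Qed.

Lemma quadratic_id : quadratic (fun z => z).
Proof. by exists 0, 1, 0 => z; ring. Qed.

Lemma quadratic_lin u : quadratic (fun z => u * z).
Proof. by exists 0, u, 0 => z; ring. Qed.

Lemma quadratic_sqr u : quadratic (fun z => u * z ^+ 2).
Proof. by exists 0, 0, u => z; ring. Qed.

#[local] Hint Resolve quadratic_cst quadratic_id quadratic_lin quadratic_sqr : core.

(** Only the restrictions of functions on the ball to discs parametrized by
    quadratic polynomials matter, so these are all that is recorded. *)
Definition ball_function (M : R) F :=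
  (forall p q z, quadratic p -> quadratic q ->
     modulus (p z) ^+ 2 + modulus (q z) ^+ 2 < 1 ->
     differentiable (fun z => F (p z) (q z)) z) /\
  (forall a b, modulus a ^+ 2 + modulus b ^+ 2 < 1 -> modulus (F a b) <= M).

Lemma ball_function_disc M F p q : ball_function M F ->
  quadratic p -> quadratic q ->
  (forall z, modulus z < 1 -> modulus (p z) ^+ 2 + modulus (q z) ^+ 2 < 1) ->
  bounded_holomorphic M (fun z => F (p z) (q z)).
Proof.
by move=> [dF FM] pp qq pq; split=> z z1; [apply: dF|apply: FM]; rewrite ?pq.
Qed.

Lemma bounded_holomorphicB M N (G H : C -> C) :
  bounded_holomorphic M G -> bounded_holomorphic N H ->
  bounded_holomorphic (M + N) (fun z => G z - H z).
Proof.
move=> [dG GM] [dH HN]; split=> z z1.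
  by apply: differentiableB; [exact: dG|exact: dH].
by rewrite (le_trans (modulusD _ _))// modulusN lerD ?GM ?HN.
Qed.

Lemma bounded_holomorphic_cst c : bounded_holomorphic (modulus c) (fun=> c : C).
Proof. by split=> // z _; exact: differentiable_cst. Qed.

Lemma bounded_holomorphic_sqr (c : C) :
  bounded_holomorphic (modulus c) (fun z => c * z ^+ 2).
Proof.
split=> z z1.
  rewrite (_ : (fun _ => _) = (fun z => c * (z * z))); last first.
    by apply/funext => w; rewrite expr2.
  by apply: differentiableM => //; apply: differentiableM.
by rewrite modulusM modulusX ler_piMr ?modulus_ge0// exprn_ile1 ?modulus_ge0// ltW.
Qed.

(** ** Interpolation in rotated coordinates *)

(** The coordinates are a = (x + y) / sqrt 2 and b = (x - y) / sqrt 2, in which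
    2 x y reads a^2 - b^2 and the nodes lie on the two axes. *)
Section FourPoints.
Variables (F : C -> C -> C) (s : R).
Hypothesis FB : ball_function 1 F.
Hypothesis s01 : 0 < s < 1.
Hypothesis F00 : F 0 0 = 0.
Hypothesis Fs0 : F s%:C 0 = (s ^+ 2)%:C.
Hypothesis FNs0 : F (- s%:C) 0 = (s ^+ 2)%:C.
Hypothesis F0s : F 0 s%:C = - (s ^+ 2)%:C.

Lemma axis_square a : modulus a < 1 -> F a 0 = a ^+ 2.
Proof.
move: a; apply: (@square_of_three_points _ (fun z => F z 0) s) => //.
apply: (@ball_function_disc 1 F (fun z => z) (fun=> 0)) => // z z1.
by rewrite modulus0 expr0n addr0 expr_lt1 ?modulus_ge0.
Qed.

Lemma vertical_disc a : modulus a <= 1 / 2 ->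
  bounded_holomorphic (1 + modulus a ^+ 2)
    (fun z => F a (2^-1 * z) - a ^+ 2).
Proof.
move=> a2; rewrite -modulusX; apply: bounded_holomorphicB; last first.
  exact: bounded_holomorphic_cst.
apply: (@ball_function_disc 1 F (fun=> a) (fun z => 2^-1 * z)) => // z z1.
rewrite modulusM (_ : 2^-1 = (2^-1 : R)%:C); last by rewrite fmorphV rmorph_nat.
rewrite modulus_real ger0_norm//.
have := modulus_ge0 z; have := modulus_ge0 a; nra.
Qed.

Lemma vertical_linear_bound a b : modulus a <= 1 / 2 -> modulus b < 1 / 2 ->
  modulus (F a b - a ^+ 2) <= 4 * modulus b.
Proof.
move=> a2 b2.
have a0 := modulus_ge0 a.
have := @schwarz_le _ _ _ (vertical_disc a2) _ (2 * b).
have m2 : modulus (2 : C) = 2 by exact: modulus_nat.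
rewrite mulKf ?pnatr_eq0// mulr0 axis_square ?subrr; last by lra.
have b21 : 2 * modulus b < 1 by lra.
rewrite modulusM m2 => /(_ erefl b21) /le_trans; apply.
have b0 := modulus_ge0 b; have a21 : modulus a ^+ 2 <= 1 by rewrite exprn_ile1//; lra.
by have := ler_wpM2r b0 a21; lra.
Qed.

(** The disc (u z, v z^2) meets the axis to second order, so [F] has a double
    zero on it by [axis_square] and [vertical_linear_bound]. *)
Lemma tangent_disc_bound u v z : modulus u ^+ 2 + modulus v ^+ 2 <= 1 ->
  modulus z < 1 -> modulus (F (u * z) (v * z ^+ 2)) <= modulus z ^+ 2.
Proof.
move=> uv z1.
have u0 := modulus_ge0 u; have v0 := modulus_ge0 v.
have u1 : modulus u <= 1 by nra.
have v1 : modulus v <= 1 by nra.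
have DB : bounded_holomorphic 1 (fun z => F (u * z) (v * z ^+ 2)).
  apply: (@ball_function_disc 1 F (fun z => u * z) (fun z => v * z ^+ 2)) => // w w1.
  have w0 := modulus_ge0 w.
  rewrite (modulusM u) (modulusM v) modulusX.
  rewrite [(modulus u * _) ^+ 2]exprMn [(modulus v * _) ^+ 2]exprMn -exprM.
  have : modulus w ^+ (2 * 2) <= modulus w ^+ 2.
    by rewrite exprM [leLHS]expr2 ler_piMr ?exprn_ge0// exprn_ile1// ltW.
  have w2 : modulus w ^+ 2 < 1 by rewrite expr_lt1.
  have := sqr_ge0 (modulus u); have := sqr_ge0 (modulus v).
  have := sqr_ge0 (modulus w); nra.
have d2 : 0 < 1 / 2 :> R by lra.
have [|K [KB FK]] := schwarz_double_zero (Q := 5) DB d2.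
  move=> w w2; have w0 := modulus_ge0 w.
  rewrite -(subrK ((u * w) ^+ 2) (F _ _)) (le_trans (modulusD _ _))//.
  have -> : 5 * modulus w ^+ 2 = 4 * modulus w ^+ 2 + modulus w ^+ 2 by ring.
  apply: lerD; last first.
    rewrite exprMn modulusM !modulusX ler_piMl ?exprn_ge0//.
    by rewrite exprn_ile1.
  rewrite (le_trans (vertical_linear_bound _ _))//.
  - by rewrite modulusM; nra.
  - by rewrite modulusM modulusX; nra.
  - by rewrite modulusM modulusX ler_pM2l// ler_piMl// exprn_ge0.
rewrite FK modulusM modulusX ler_piMr ?exprn_ge0 ?modulus_ge0//.
exact: KB.2.
Qed.

Lemma tangent_bound a b : a != 0 ->
  modulus a ^+ 2 + modulus b ^+ 2 / modulus a ^+ 2 < 1 ->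
  modulus (F a b) <= modulus a ^+ 2 + modulus b ^+ 2 / modulus a ^+ 2.
Proof.
rewrite -modulus_gt0 => a0; set t := _ + _ => t1.
have a20 : 0 < modulus a ^+ 2 by rewrite exprn_gt0.
have b20 : 0 <= modulus b ^+ 2 by rewrite exprn_ge0// modulus_ge0.
have q0 : 0 <= modulus b ^+ 2 / modulus a ^+ 2 by rewrite divr_ge0// ltW.
have t0 : 0 < t by rewrite /t; lra.
(* The point (a, b) is the value at sqrt t of the disc with these coefficients;
   t ^+ 2 is at least |a|^2 t + |b|^2, which keeps the disc inside the ball. *)
pose r := Num.sqrt t.
have r2 : r ^+ 2 = t by rewrite sqr_sqrtr// ltW.
have r0 : 0 < r by rewrite sqrtr_gt0.
have mr : modulus r%:C = r by rewrite modulus_real gtr0_norm.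
have rC0 : r%:C != 0 by rewrite -modulus_gt0 mr.
have := @tangent_disc_bound (a / r%:C) (b / r%:C ^+ 2) r%:C.
rewrite mr r2 divfK// divfK ?expf_neq0//; apply.
  rewrite (modulusM a) (modulusM b) !modulusV modulusX mr r2.
  rewrite [(modulus a * _) ^+ 2]exprMn [(modulus b * _) ^+ 2]exprMn !exprVn r2.
  have qE : modulus b ^+ 2 / modulus a ^+ 2 * modulus a ^+ 2 = modulus b ^+ 2.
    by rewrite divfK// gt_eqF.
  rewrite -(@ler_pM2r _ (t ^+ 2)) ?exprn_gt0// mul1r.
  rewrite (_ : _ * _ = modulus a ^+ 2 * t + modulus b ^+ 2); last first.
    by field; rewrite gt_eqF.
  rewrite /t; move: qE; set q := _ / _ => qE; nra.
by rewrite -(expr_lt1 (n := 2)) ?r2 ?ltW.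
Qed.

(** The tangential discs bound [F] to second order in [b], which kills the
    derivative transversal to the axis. *)
Lemma vertical_quadratic_bound_neq0 a b : a != 0 -> modulus a <= 1 / 2 ->
  modulus b < 1 / 2 -> modulus (F a b - a ^+ 2) <= 8 * modulus b ^+ 2.
Proof.
move=> an0 a2 b2.
have a0 : 0 < modulus a by rewrite modulus_gt0.
have a1 : modulus a < 1 by lra.
have [|H [HB FH]] := schwarz (vertical_disc a2).
  by rewrite mulr0 axis_square ?subrr.
have m2 : modulus (2 : C) = 2 by exact: modulus_nat.
have z1 : modulus (0 : C) < 1 by rewrite modulus0.
have H0 : H 0 = 0.
  apply/eqP; rewrite -[_ == _]negbK; apply/negP; rewrite -modulus_gt0.
  set l := H 0 => l0.
  have l2 : 0 < modulus l / 2 by lra.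
  have [d d0 Hd] := differentiable_cont_modulus (HB.1 _ z1) l2.
  pose m := modulus a ^+ 2.
  have m0 : 0 < m by rewrite exprn_gt0.
  have m4 : m <= 1 / 4 by rewrite /m; nra.
  pose t := Num.min (Num.min (d / 2) (m / 2)) (m * modulus l).
  have t0 : 0 < t by rewrite !lt_min !divr_gt0//= mulr_gt0.
  have td : t <= d / 2 by rewrite !ge_min lexx.
  have tm : t <= m / 2 by rewrite !ge_min lexx orbT.
  have tl : t <= m * modulus l by rewrite !ge_min lexx orbT.
  (* The direction of b' aligns the linear term l * b' with a ^+ 2. *)
  pose b' : C := (t / (modulus l * m))%:C * (l^*%C * a ^+ 2).
  have mb' : modulus b' = t.
    rewrite modulusM (modulusM l^*%C) modulus_real modulus_conj modulusX -/m.
    by rewrite gtr0_norm ?divr_gt0 ?mulr_gt0// divfK// gt_eqF// mulr_gt0.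
  have b'l : b' * l = (t * modulus l / m)%:C * a ^+ 2.
    rewrite /b' -mulrA (_ : l^*%C * _ * l = (l * l^*%C) * a ^+ 2); last by ring.
    rewrite -sqr_normc modulusE -rmorphXn mulrA -rmorphM; congr (_%:C * _).
    by field; rewrite !gt_eqF.
  have Hb' : modulus (H b' - l) <= modulus l / 2.
    by apply: Hd; rewrite subr0 mb'; lra.
  have half : modulus (2^-1 * b') = t / 2.
    by rewrite modulusM modulusV m2 mb' mulrC.
  have tt : (t / 2) ^+ 2 / m <= t / 8.
    rewrite ler_pdivrMr//; nra.
  have := @tangent_bound a (2^-1 * b') an0; rewrite half -/m.
  have -> : F a (2^-1 * b') = a ^+ 2 * (1 + (t * modulus l / m)%:C) + b' * (H b' - l).
    by rewrite -[F _ _](subrK (a ^+ 2)) FH mulrBr b'l; ring.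
  have tl' : (t / 2) ^+ 2 / m <= t * modulus l / 4.
    rewrite ler_pdivrMr//; nra.
  have t1 : m + (t / 2) ^+ 2 / m < 1 by lra.
  move=> /(_ t1); apply/negP; rewrite -ltNge.
  have := modulus_dist (a ^+ 2 * (1 + (t * modulus l / m)%:C)) (- (b' * (H b' - l))).
  rewrite opprK modulusN (modulusM (a ^+ 2)) (modulusM b') modulusX -/m mb'.
  rewrite -(rmorph1 (@real_complex R)) -rmorphD modulus_real.
  have q0 : 0 <= t * modulus l / m by rewrite divr_ge0 ?mulr_ge0// ltW.
  rewrite ger0_norm ?addr_ge0//.
  have -> : m * (1 + t * modulus l / m) = m + t * modulus l.
    by field; rewrite gt_eqF.
  have := ler_wpM2l (ltW t0) Hb'; have := mulr_gt0 t0 l0; lra.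
have [K [KB HK]] := schwarz HB H0.
have -> : F a b - a ^+ 2 = (2 * b) ^+ 2 * K (2 * b).
  by rewrite expr2 -mulrA -HK -FH mulKf ?pnatr_eq0.
have mb : modulus (2 * b) = 2 * modulus b by rewrite modulusM m2.
have K2 : modulus (K (2 * b)) <= 2.
  apply: (le_trans (KB.2 _ _)); first by rewrite mb; lra.
  by nra.
rewrite modulusM modulusX mb exprMn.
have := sqr_ge0 (modulus b); nra.
Qed.

(** Continuity in [a] carries the bound over to the axis a = 0. *)
Lemma vertical_quadratic_bound a b : modulus a <= 1 / 2 ->
  modulus b < 1 / 2 -> modulus (F a b - a ^+ 2) <= 8 * modulus b ^+ 2.
Proof.
move=> a2 b2; have [a0|a0] := eqVneq a 0; last first.
  exact: vertical_quadratic_bound_neq0.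
rewrite a0; apply: le_of_all_addgt0 => e e0.
pose G z := F z b - z ^+ 2.
have z1 : modulus (0 : C) < 1 by rewrite modulus0.
have dG : differentiable G 0.
  apply: differentiableB; last first.
    by have := (bounded_holomorphic_sqr 1).1 _ z1; under eq_fun do rewrite mul1r.
  apply: (FB.1 (fun z => z) (fun=> b)) => //.
  rewrite modulus0; have := modulus_ge0 b; nra.
have [d d0 Gd] := differentiable_cont_modulus dG e0.
pose x := Num.min (d / 2) (1 / 2).
have x0 : 0 < x by rewrite lt_min; apply/andP; split; lra.
have xd : x <= d / 2 by rewrite ge_min lexx.
have x2 : x <= 1 / 2 by rewrite ge_min lexx orbT.
have mx : modulus x%:C = x by rewrite modulus_real gtr0_norm.
have := Gd x%:C; rewrite subr0 mx => /(_ _)H.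
have {}H : modulus (G x%:C - G 0) <= e by apply: H; lra.
have := @vertical_quadratic_bound_neq0 x%:C b; rewrite -modulus_gt0 mx.
move=> /(_ x0 x2 b2) Gx.
have := modulus_dist (G 0) (G x%:C); rewrite modulusB /G in H *; lra.
Qed.

(** The bound at a = 0 shows a double zero along the other axis, and the value
    at the fourth node then attains equality in Schwarz's lemma. *)
Lemma other_axis_square b : modulus b < 1 -> F 0 b = - b ^+ 2.
Proof.
have DB : bounded_holomorphic 1 (fun z => F 0 z).
  apply: (@ball_function_disc 1 F (fun=> 0) (fun z => z)) => // z z1.
  by rewrite modulus0 expr0n add0r expr_lt1 ?modulus_ge0.
have d2 : 0 < 1 / 2 :> R by lra.
have [|K [KB FK]] := schwarz_double_zero (Q := 8) DB d2.
  move=> z z2; have := @vertical_quadratic_bound 0 z.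
  by rewrite modulus0 expr0n subr0; apply; lra.
have /andP[s0 s1] := s01.
have ms : modulus s%:C = s by rewrite modulus_real gtr0_norm.
have sC0 : s%:C != 0 by rewrite -modulus_gt0 ms.
have Ks : K s%:C = -1.
  apply: (mulfI (expf_neq0 2 sC0)); rewrite -FK F0s mulrN1.
  by rewrite -rmorphXn.
move=> b1; rewrite FK (bounded_holomorphic_rigid KB (z0 := s%:C)) ?ms//.
  by rewrite Ks mulrN1.
by rewrite Ks modulusN modulus1.
Qed.

(** What is left after removing the values on both axes vanishes with [a] and is
    of second order in [b]; being of third order in all, it does not disturb the
    quadratic part. *)
Lemma mixed_bound a b : modulus a < 1 / 2 -> modulus b < 1 / 2 ->
  modulus (F a b - (a ^+ 2 - b ^+ 2)) <= 32 * modulus b ^+ 2 * modulus a.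
Proof.
move=> a2 b2.
have b0 := modulus_ge0 b.
have m2 : modulus (2 : C) = 2 by exact: modulus_nat.
pose G z := F (2^-1 * z) b - (2^-1 * z) ^+ 2 + b ^+ 2.
have half z : modulus (2^-1 * z) = modulus z / 2.
  by rewrite modulusM modulusV m2 mulrC.
have GB : bounded_holomorphic (16 * modulus b ^+ 2) G.
  split=> z z1.
    apply: differentiableD; last exact: differentiable_cst.
    apply: differentiableB.
      apply: (FB.1 (fun z => 2^-1 * z) (fun=> b)) => //.
      by rewrite half; have := modulus_ge0 z; nra.
    have := (bounded_holomorphic_sqr (2^-1 ^+ 2)).1 _ z1.
    by under eq_fun do rewrite -exprMn.
  rewrite (le_trans (modulusD _ _))// modulusX.
  have := @vertical_quadratic_bound (2^-1 * z) b; rewrite half.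
  have z2 : modulus z / 2 <= 1 / 2 by lra.
  move=> /(_ z2 b2); have := sqr_ge0 (modulus b); lra.
have G0 : G 0 = 0 by rewrite /G mulr0 other_axis_square; [ring|lra].
have := schwarz_le GB G0 (z := 2 * a); rewrite modulusM m2.
have a21 : 2 * modulus a < 1 by lra.
move=> /(_ a21); rewrite /G mulKf ?pnatr_eq0// opprB addrA addrAC.
by move=> /le_trans; apply; rewrite le_eqVlt; apply/orP; left; apply/eqP; ring.
Qed.

(** On lines through points where the model has modulus one, the quotient by
    z^2 is unimodular at the origin, hence constant. *)
Lemma peak_line a b z : modulus a ^+ 2 + modulus b ^+ 2 <= 1 ->
  modulus (a ^+ 2 - b ^+ 2) = 1 -> modulus z < 1 ->
  F (a * z) (b * z) = z ^+ 2 * (a ^+ 2 - b ^+ 2).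
Proof.
move=> ab ab1 z1.
have a0 := modulus_ge0 a; have b0 := modulus_ge0 b.
have a1 : modulus a <= 1 by nra.
have b1 : modulus b <= 1 by nra.
have DB : bounded_holomorphic 1 (fun z => F (a * z) (b * z)).
  apply: (@ball_function_disc 1 F (fun z => a * z) (fun z => b * z)) => // w w1.
  rewrite !modulusM !exprMn -mulrDl.
  have w2 : modulus w ^+ 2 < 1 by rewrite expr_lt1 ?modulus_ge0.
  have := sqr_ge0 (modulus w); nra.
pose m := a ^+ 2 - b ^+ 2.
have loc w : modulus w < 1 / 2 ->
    modulus (F (a * w) (b * w) - w ^+ 2 * m) <= 32 * modulus w ^+ 3.
  move=> w2; have w0 := modulus_ge0 w.
  have -> : w ^+ 2 * m = (a * w) ^+ 2 - (b * w) ^+ 2 by rewrite /m; ring.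
  rewrite (le_trans (mixed_bound _ _)) ?modulusM//; try nra.
  rewrite (_ : 32 * _ * _ = 32 * modulus w ^+ 3 * (modulus b ^+ 2 * modulus a));
    last by ring.
  rewrite ler_piMr ?mulr_ge0 ?exprn_ge0//.
  by rewrite mulr_ile1 ?exprn_ge0// exprn_ile1.
have d2 : 0 < 1 / 2 :> R by lra.
have [|K [KB FK]] := schwarz_double_zero (Q := 33) DB d2.
  move=> w w2; have w0 := modulus_ge0 w.
  rewrite -(subrK (w ^+ 2 * m) (F _ _)) (le_trans (modulusD _ _))//.
  rewrite [X in _ + X]modulusM ab1 modulusX mulr1.
  have := loc _ w2; have : modulus w ^+ 3 <= modulus w ^+ 2.
    by rewrite [leLHS]exprS ler_piMl ?exprn_ge0//; lra.
  lra.
have z01 : modulus (0 : C) < 1 by rewrite modulus0.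
have K0 : K 0 = m.
  apply/eqP; rewrite -subr_eq0; apply/eqP.
  apply: (@eq0_of_linear_bound _ (fun z => K z - m) (1 / 2) 32).
  - by apply: differentiableB; [exact: KB.1|exact: differentiable_cst].
  - exact: d2.
  move=> w w0 /loc; rewrite FK -mulrBr modulusM modulusX.
  by rewrite [_ ^+ 3]exprSr mulrCA ler_pM2l// exprn_gt0 ?modulus_gt0.
have := bounded_holomorphic_rigid KB z01; rewrite K0 => /(_ ab1 _ z1) Kz.
by rewrite FK Kz.
Qed.


End FourPoints.

(** ** Uniqueness of the interpolant 2 x y *)

Lemma parallelogram (h : R) a b : h ^+ 2 = 1 / 2 ->
  modulus (h%:C * (a + b)) ^+ 2 + modulus (h%:C * (a - b)) ^+ 2 =
  modulus a ^+ 2 + modulus b ^+ 2.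
Proof.
move=> h2; rewrite !modulusM !modulus_real ![(_ * _) ^+ 2]exprMn.
rewrite real_normK ?num_real// h2 !modulus_sqr.
by case: a => a1 a2; case: b => b1 b2 /=; field.
Qed.

Lemma ball_function_rotate f (h : R) : h ^+ 2 = 1 / 2 -> ball_function 1 f ->
  ball_function 1 (fun a b => f (h%:C * (a + b)) (h%:C * (a - b))).
Proof.
move=> h2 [df f1]; split=> [p q z [p0 [p1 [p2 pE]]] [q0 [q1 [q2 qE]]] pq|a b ab].
  apply: (df (fun z => h%:C * (p z + q z)) (fun z => h%:C * (p z - q z))).
  - exists (h%:C * (p0 + q0)), (h%:C * (p1 + q1)), (h%:C * (p2 + q2)) => w.
    by rewrite pE qE; ring.
  - exists (h%:C * (p0 - q0)), (h%:C * (p1 - q1)), (h%:C * (p2 - q2)) => w.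
    by rewrite pE qE; ring.
  - by rewrite parallelogram.
by apply: f1; rewrite parallelogram.
Qed.

Lemma modulus_product_le x y :
  2 * (modulus x * modulus y) <= modulus x ^+ 2 + modulus y ^+ 2.
Proof. by have := sqr_ge0 (modulus x - modulus y); nra. Qed.

(** By [peak_line] the two functions agree where x and y have equal moduli, hence
    near the origin by the maximum principle in one variable, hence along every
    line through the origin. *)
Lemma four_point_uniqueness f : ball_function 1 f ->
  f 0 0 = 0 -> f 2^-1 2^-1 = 2^-1 -> f (- 2^-1) (- 2^-1) = 2^-1 ->
  f 2^-1 (- 2^-1) = - 2^-1 ->
  forall x y, modulus x ^+ 2 + modulus y ^+ 2 < 1 -> f x y = 2 * x * y.
Proof.
move=> fB f0 fpp fmm fpm.
pose h : R := (Num.sqrt 2)^-1.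
have h0 : 0 < h by rewrite invr_gt0 sqrtr_gt0.
have h2 : h ^+ 2 = 1 / 2 by rewrite exprVn sqr_sqrtr// mul1r.
have h1 : h < 1 by nra.
have hC0 : h%:C != 0 by rewrite -modulus_gt0 modulus_real gtr0_norm.
have hh : h%:C * h%:C = 2^-1.
  by rewrite -rmorphM -expr2 h2 mul1r fmorphV rmorph_nat.
have h2C : (h ^+ 2)%:C = 2^-1 by rewrite h2 mul1r fmorphV rmorph_nat.
pose F a b := f (h%:C * (a + b)) (h%:C * (a - b)).
have FB : ball_function 1 F by exact: ball_function_rotate.
have fF x y : f x y = F (h%:C * (x + y)) (h%:C * (x - y)).
  by congr f; rewrite -?mulrDr -?mulrBr mulrA hh; field.
have h01 : 0 < h < 1 by rewrite h0.
have F00 : F 0 0 = 0 by rewrite /F addr0 subr0 mulr0.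
have Fh0 : F h%:C 0 = (h ^+ 2)%:C by rewrite /F addr0 subr0 hh h2C.
have FNh0 : F (- h%:C) 0 = (h ^+ 2)%:C.
  by rewrite /F addr0 subr0 mulrN hh h2C.
have F0h : F 0 h%:C = - (h ^+ 2)%:C.
  by rewrite /F add0r sub0r mulrN hh h2C.
have m2 : modulus (2 : C) = 2 by exact: modulus_nat.
have torus x y : modulus x = modulus y -> modulus x ^+ 2 < 1 / 2 ->
    f x y = 2 * x * y.
  move=> xy x2; have [x0|xn0] := eqVneq x 0.
    have -> : y = 0 by apply: modulus_eq0; rewrite -xy x0 modulus0.
    by rewrite x0 f0 mulr0.
  have x0 : 0 < modulus x by rewrite modulus_gt0.
  have xn : modulus x != 0 by rewrite gt_eqF.
  pose u := (modulus x)%:C / h%:C.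
  have mu : modulus u = modulus x / h.
    by rewrite modulusM modulusV !modulus_real !gtr0_norm.
  have u0 : u != 0 by rewrite -modulus_gt0 mu divr_gt0.
  have mu2 : modulus u ^+ 2 = 2 * modulus x ^+ 2.
    by rewrite mu expr_div_n h2; field.
  have u1 : modulus u < 1.
    by rewrite -(expr_lt1 (n := 2)) ?modulus_ge0// mu2; lra.
  clearbody u; pose a := h%:C * (x + y) / u; pose b := h%:C * (x - y) / u.
  have ab : a ^+ 2 - b ^+ 2 = 2 * x * y / u ^+ 2.
    rewrite /a /b !expr_div_n ![(_ * _) ^+ 2]exprMn.
    rewrite -mulrBl -mulrBr [h%:C ^+ 2]expr2 hh; by field.
  have ab1 : modulus (a ^+ 2 - b ^+ 2) = 1.
    rewrite ab modulusM modulusV modulusX mu2 -mulrA (modulusM 2) m2 (modulusM x).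
    by rewrite -xy expr2 divff// !mulf_neq0.
  have abn : modulus a ^+ 2 + modulus b ^+ 2 <= 1.
    rewrite /a /b !(modulusM _ u^-1) modulusV.
    rewrite ![(_ * (modulus u)^-1) ^+ 2]exprMn -mulrDl parallelogram//.
    rewrite -xy exprVn mu2 (_ : _ + _ = 2 * modulus x ^+ 2); last by ring.
    by rewrite divff// mulf_neq0 ?expf_neq0.
  rewrite fF -[h%:C * (x + y)](divfK u0) -[h%:C * (x - y)](divfK u0).
  rewrite (peak_line FB h01 F00 Fh0 FNh0 F0h)// ab mulrC divfK//.
  by rewrite expf_neq0.
have dprod (p q : C -> C) z : quadratic p -> quadratic q ->
    differentiable (fun z => 2 * p z * q z) z.
  have dquad (g : C -> C) : quadratic g -> differentiable g z.
    move=> [g0 [g1 [g2 gE]]].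
    rewrite (_ : g = (fun z => g0 + g1 * z + g2 * (z * z))).
      apply: differentiableD; first by apply: differentiableD => //; exact: differentiableM.
      by apply: differentiableM => //; exact: differentiableM.
    by apply/funext => w; rewrite gE expr2.
  move=> /dquad dp /dquad dq; apply: differentiableM; last exact: dq.
  by apply: differentiableM; [exact: differentiable_cst|exact: dp].
have near0 x y : modulus x ^+ 2 < 1 / 2 -> modulus y ^+ 2 < 1 / 2 ->
    f x y = 2 * x * y.
  move=> x2 y2; have x0 := modulus_ge0 x; have y0 := modulus_ge0 y.
  case: (ltgtP (modulus x) (modulus y)) => [xy|yx|xy]; last exact: torus.
  - apply/eqP; rewrite -subr_eq0; apply/eqP/modulus_eq0/eqP.
    rewrite eq_le modulus_ge0 andbT.
    apply: (@maximum_principle _ (fun x => f x y - 2 * x * y) _ 0 x xy).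
      move=> z zy; have z0 := modulus_ge0 z.
      apply: differentiableB; last exact: (dprod (fun z => z) (fun=> y)).
      by apply: (fB.1 (fun z => z) (fun=> y)) => //; nra.
    by move=> z zy; rewrite torus ?subrr ?modulus0// zy.
  - apply/eqP; rewrite -subr_eq0; apply/eqP/modulus_eq0/eqP.
    rewrite eq_le modulus_ge0 andbT.
    apply: (@maximum_principle _ (fun y => f x y - 2 * x * y) _ 0 y yx).
      move=> z zx; have z0 := modulus_ge0 z.
      apply: differentiableB; last exact: (dprod (fun=> x) (fun z => z)).
      by apply: (fB.1 (fun=> x) (fun z => z)) => //; nra.
    by move=> z zx; rewrite torus ?subrr ?modulus0.
move=> x y xy1.
have x0 := modulus_ge0 x; have y0 := modulus_ge0 y.
have xx0 := sqr_ge0 (modulus x); have yy0 := sqr_ge0 (modulus y).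
pose n := Num.sqrt (modulus x ^+ 2 + modulus y ^+ 2).
have n2 : n ^+ 2 = modulus x ^+ 2 + modulus y ^+ 2.
  by rewrite sqr_sqrtr// addr_ge0.
have [n0|nn0] := eqVneq n 0.
  by apply: near0; move: n2; rewrite n0 expr0n/=; lra.
have n0 : 0 < n by rewrite lt_neqAle eq_sym nn0 sqrtr_ge0.
have n1 : n < 1 by rewrite -(expr_lt1 (n := 2)) ?n2 ?ltW.
have mn : modulus n%:C = n by rewrite modulus_real gtr0_norm.
have nC0 : n%:C != 0 by rewrite -modulus_gt0 mn.
pose G z := f (x / n%:C * z) (y / n%:C * z) - 2 * (x / n%:C * z) * (y / n%:C * z).
have scaled z : modulus (x / n%:C * z) ^+ 2 + modulus (y / n%:C * z) ^+ 2 =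
    modulus z ^+ 2.
  rewrite !(modulusM _ z) (modulusM x) (modulusM y) modulusV mn.
  rewrite ![(_ * modulus z) ^+ 2]exprMn -mulrDl ![(_ / n) ^+ 2]exprMn -mulrDl.
  by rewrite -n2 exprVn divff ?mul1r// expf_neq0.
have scaled1 z : modulus z < 1 ->
    modulus (x / n%:C * z) ^+ 2 + modulus (y / n%:C * z) ^+ 2 < 1.
  by move=> z1; rewrite scaled expr_lt1 ?modulus_ge0.
have GB : bounded_holomorphic 2 G.
  split=> z z1.
    apply: differentiableB; last first.
      by apply: (dprod (fun z => x / n%:C * z) (fun z => y / n%:C * z)).
    by apply: (fB.1 (fun z => x / n%:C * z) (fun z => y / n%:C * z)) => //; exact: scaled1.
  have H1 := fB.2 _ _ (scaled1 _ z1).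
  have H2 := modulus_product_le (x / n%:C * z) (y / n%:C * z).
  have H3 := scaled1 _ z1.
  rewrite (le_trans (modulusD _ _))// modulusN -[2 * _ * _]mulrA (modulusM 2) m2.
  rewrite (modulusM (x / n%:C * z)); lra.
have d2 : 0 < 1 / 2 :> R by lra.
have G0 z : modulus z < 1 / 2 -> G z = 0.
  move=> z2; have := scaled z; have z0 := modulus_ge0 z.
  have H1 := sqr_ge0 (modulus (x / n%:C * z)).
  have H2 := sqr_ge0 (modulus (y / n%:C * z)).
  have z4 : modulus z ^+ 2 < 1 / 2 by nra.
  by move=> H; rewrite /G near0 ?subrr//; lra.
have := bounded_holomorphic_eq0 GB d2 G0 (z := n%:C); rewrite mn => /(_ n1).
by rewrite /G !divfK// => /eqP; rewrite subr_eq0 => /eqP.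
Qed.

End Ball.

(** * The torus |x| = |y| = h *)

Section Torus.
Variable R : realType.
Notation C := R[i].

Lemma is_derive_wave (A B x : R) :
  is_derive x 1 (fun x => A * cos (2 * pi * x) + B * sin (2 * pi * x))
    (2 * pi * (B * cos (2 * pi * x) - A * sin (2 * pi * x))).
Proof.
have dl : is_derive x 1 (fun x : R => 2 * pi * x) (2 * pi).
  have -> : (fun x : R => 2 * pi * x) = (2 * pi) \*: id by [].
  by apply: is_derive_eq; rewrite /GRing.scale/= mulr1.
have dc : is_derive x 1 (cos \o (fun x : R => 2 * pi * x))
    (- sin (2 * pi * x) * (2 * pi)) by exact: is_derive1_comp.
have ds : is_derive x 1 (sin \o (fun x : R => 2 * pi * x))
    (cos (2 * pi * x) * (2 * pi)) by exact: is_derive1_comp.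
have -> : (fun x => A * cos (2 * pi * x) + B * sin (2 * pi * x)) =
  A \*: (cos \o (fun x : R => 2 * pi * x)) +
  B \*: (sin \o (fun x : R => 2 * pi * x)) by [].
by apply: is_derive_eq; rewrite /GRing.scale/=; ring.
Qed.

(** Maps between real coordinate spaces each of whose components is a
    trigonometric function of one coordinate; partial derivatives stay in this
    class, which makes its members smooth by induction. *)
Definition wave m n (s : 'I_n -> 'I_m) (A B : 'I_n -> R) (t : 'rV[R]_m) :
    'rV[R]_n :=
  \row_k (A k * cos (2 * pi * t ord0 (s k)) + B k * sin (2 * pi * t ord0 (s k))).

Section Wave.
Variables (m n : nat) (s : 'I_n -> 'I_m).
Implicit Types (A B : 'I_n -> R) (t u : 'rV[R]_m).

Let component_differentiable A B t k :
  differentiable (fun t => A k * cos (2 * pi * t ord0 (s k)) +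
    B k * sin (2 * pi * t ord0 (s k))) t.
Proof.
apply: (@differentiable_comp _ _ _ _ (fun t : 'rV[R]_m => t ord0 (s k) : R)
  (fun x : R => A k * cos (2 * pi * x) + B k * sin (2 * pi * x))).
  exact: differentiable_coord.
exact/derivable1_diffP/(@ex_derive _ _ _ _ _ _ _ (is_derive_wave _ _ _)).
Qed.

Lemma wave_differentiable A B t : differentiable (wave s A B) t.
Proof.
have -> : wave s A B = \sum_(k < n) (fun t => (A k * cos (2 * pi * t ord0 (s k)) +
    B k * sin (2 * pi * t ord0 (s k))) *: delta_mx ord0 k).
  apply/funext => u; rewrite fct_sumE; apply/rowP => k; rewrite summxE.
  rewrite (bigD1 k)//= big1 ?addr0; last first.
    by move=> l lk; rewrite !mxE eqxx [k == l]eq_sym (negPf lk) mulr0.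
  by rewrite !mxE !eqxx mulr1.
apply: differentiable_sum => k; apply: differentiableZl.
exact: component_differentiable.
Qed.

Lemma wave_derive A B t u : 'D_u (wave s A B) t =
  \row_k (u ord0 (s k) * (2 * pi * (B k * cos (2 * pi * t ord0 (s k))
                          - A k * sin (2 * pi * t ord0 (s k))))).
Proof.
have wd : derivable (wave s A B) t u by apply: diff_derivable; exact: wave_differentiable.
rewrite derive_mx//; apply/matrixP => i k; rewrite ord1 !mxE.
under eq_fun do rewrite mxE.
have := is_derive_wave (A k) (B k) (t ord0 (s k)).
set phi := (fun x : R => _ + _) => dphi.
have dp : differentiable phi (t ord0 (s k)).
  by apply/derivable1_diffP; case: dphi.
have -> : 'D_u (fun t : 'rV[R]_m => A k * cos (2 * pi * t ord0 (s k)) +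
    B k * sin (2 * pi * t ord0 (s k))) t = 'D_(u ord0 (s k)) phi (t ord0 (s k)).
  rewrite /derive [X in lim (X @ _) = _](_ : _ = (fun h : R => h^-1 *:
    ((phi \o shift (t ord0 (s k))) (h *: u ord0 (s k)) - phi (t ord0 (s k)))))//.
  by apply/funext => h /=; rewrite !mxE.
rewrite deriveE// -[X in 'd _ _ X]mulr1 [LHS]linearZ/= -deriveE//.
by rewrite (@derive_val _ _ _ _ _ _ _ dphi).
Qed.

Lemma wave_smooth A B : smooth (wave s A B).
Proof.
move=> k; elim: k A B => [|k IH] A B /=.
  by move=> t; apply: differentiable_continuous; exact: wave_differentiable.
split=> [t|i]; first exact: wave_differentiable.
rewrite (_ : (fun t => _) = wave s
  (fun k => (s k == i)%:R * (2 * pi * B k))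
  (fun k => - ((s k == i)%:R * (2 * pi * A k)))); first exact: IH.
apply/funext => t; rewrite wave_derive; apply/rowP => j; rewrite !mxE.
by rewrite eqxx/=; ring.
Qed.

End Wave.

Lemma turn_int (n : int) : turn (n%:~R : R) = 1.
Proof.
have H (k : nat) : turn (k%:R : R) = 1.
  by elim: k => [|k IH]; rewrite ?turn0// -natr1 turnD IH turn1 mulr1.
by case: n => k; rewrite ?NegzE ?rmorphN ?turnN H ?invr1.
Qed.

Lemma turn_eq1 (x : R) : turn x = 1 -> exists n : int, x = n%:~R.
Proof.
move=> x1; exists (Num.floor x); apply/eqP; rewrite -subr_eq0; apply/eqP.
set y := x - _.
have y1 : turn y = 1 by rewrite turnD -mulrN1z turnN turn_int x1 invr1 mulr1.
have /andP[y0 yl] : 0 <= y < 1.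
  rewrite subr_ge0 Num.Theory.floor_le/= ltrBlDr addrC.
  by have := floorD1_gt x; rewrite intrD.
have cos1 (z : R) : 0 <= z <= 1 / 2 -> turn z = 1 -> z = 0.
  move=> /andP[z0 z2] /(congr1 (@complex.Re R))/= cz.
  have p0 : 0 < pi :> R := pi_gt0 R.
  have : 2 * pi * z = 0.
    apply: cos_inj; last by rewrite cos0.
      by rewrite in_itv/=; apply/andP; split; nra.
    by rewrite in_itv/= lexx ltW.
  by move=> /eqP; rewrite mulf_eq0 gt_eqF/= ?mulr_gt0// => /eqP.
have [y2|y2] := leP y (1 / 2); first by apply: cos1 => //; rewrite y0.
have : 1 - y = 0 by apply: cos1; [lra|rewrite turnD turnN turn1 y1 invr1 mulr1].
by lra.
Qed.

Lemma turn_eq (x y : R) : turn x = turn y <-> exists n : int, x - y = n%:~R.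
Proof.
split=> [xy|[n xy]].
  by apply: turn_eq1; rewrite turnD turnN xy divff// turn_neq0.
by rewrite -(subrK y x) xy turnD turn_int mul1r.
Qed.

Lemma turn_surj (w : C) : modulus w = 1 -> exists t, w = turn t.
Proof.
move=> w1; have p0 : 0 < pi :> R := pi_gt0 R.
have := modulus_sqr w; rewrite w1 expr1n.
case: w w1 => a b _ /= ab.
have a1 : -1 <= a <= 1.
  rewrite -ler_norml -(ler_pXn2r (n := 2)) ?nnegrE// real_normK ?num_real//.
  by rewrite expr1n ab lerDl sqr_ge0.
have cosa : cos (acos a) = a by rewrite acosK// in_itv.
have sinb : sin (acos a) ^+ 2 = b ^+ 2.
  by rewrite sin2cos2 cosa ab; ring.
have pt (x : R) : 2 * pi * (x / (2 * pi)) = x.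
  by rewrite mulrC divfK// gt_eqF// mulr_gt0.
move: sinb => /eqP; rewrite eqf_sqr => /orP[] /eqP sinb.
  by exists (acos a / (2 * pi)); rewrite /turn pt cosa sinb.
exists (- acos a / (2 * pi)); rewrite /turn pt cosN sinN cosa sinb opprK//.
Qed.

Definition torus_map (h : R) d (t : 'rV[R]_d) : 'rV[C]_d :=
  \row_j (h%:C * turn (t ord0 j)).

Let cos_coef (h : R) d (k : 'I_(d + d)) := if fintype.split k is inl _ then h else 0.
Let sin_coef (h : R) d (k : 'I_(d + d)) := if fintype.split k is inl _ then 0 else h.
Let angle d (k : 'I_(d + d)) : 'I_d := match fintype.split k with inl j | inr j => j end.

Let realify_torus_map h d : (fun t => realify (@torus_map h d t)) =
  wave (@angle d) (@cos_coef h d) (@sin_coef h d).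
Proof.
apply/funext => t; apply/rowP => k; rewrite /realify /cos_coef /sin_coef /angle.
by rewrite !mxE; case: (fintype.split k) => j; rewrite !mxE/=; ring.
Qed.

(** The immersion condition holds as sine and cosine do not vanish together,
    and the fibres are lattice cosets as [turn] has kernel the integers. *)
Lemma torus_map_is_torus (h : R) d : 0 < h ->
  is_torus d (range (@torus_map h d)).
Proof.
move=> h0; exists (@torus_map h d); split=> //.
- by rewrite realify_torus_map; exact: wave_smooth.
- move=> t u; rewrite realify_torus_map -deriveE; last exact: wave_differentiable.
  rewrite wave_derive => /rowP E; apply/rowP => j; rewrite mxE.
  have := E (lshift d j); have := E (rshift d j); rewrite !mxE.
  rewrite /cos_coef /sin_coef /angle -[lshift d j]/(unsplit (inl j)).
  rewrite -[rshift d j]/(unsplit (inr j)) !unsplitK.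
  have p0 : 0 < pi :> R := pi_gt0 R.
  set c := cos _; set s' := sin _ => Ec Es.
  have cs : c ^+ 2 + s' ^+ 2 = 1 by exact: cos2Dsin2.
  have ph : 2 * pi * h != 0 by rewrite gt_eqF// !mulr_gt0.
  apply: (mulfI ph); rewrite mulr0.
  have -> : 2 * pi * h * u ord0 j = c * (u ord0 j * (2 * pi * (h * c - 0 * s')))
    - s' * (u ord0 j * (2 * pi * (0 * c - h * s'))).
    by rewrite -[LHS]mulr1 -cs; ring.
  by rewrite Ec Es !mulr0 subrr.
- have hC0 : h%:C != 0 by rewrite -modulus_gt0 modulus_real normr_gt0 gt_eqF.
  move=> s t; split=> [/rowP st|[m st]].
    have H j : exists n : int, s ord0 j - t ord0 j = n%:~R.
      by apply/turn_eq/(mulfI hC0); have := st j; rewrite !mxE.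
    have [g gP] := choice H.
    by exists (\row_j g j); apply/rowP => j; rewrite !mxE gP.
  apply/rowP => j; rewrite !mxE; congr (_ * _); apply/turn_eq.
  by exists (m ord0 j); move/rowP: st => /(_ j); rewrite !mxE.
Qed.

Lemma range_torus_map (h : R) d (z : 'rV[C]_d) : 0 < h ->
  range (@torus_map h d) z <-> forall j, modulus (z ord0 j) = h.
Proof.
move=> h0; have hC0 : h%:C != 0 by rewrite -modulus_gt0 modulus_real normr_gt0 gt_eqF.
split=> [[t _ <-] j|zh].
  by rewrite mxE modulusM modulus_real modulus_turn mulr1 gtr0_norm.
have H j : exists t, z ord0 j / h%:C = turn t.
  apply: turn_surj; rewrite modulusM modulusV zh modulus_real gtr0_norm// divff//.
  by rewrite gt_eqF.
have [t tP] := choice H.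
by exists (\row_j t j) => //; apply/rowP => j; rewrite !mxE -tP mulrC divfK.
Qed.

End Torus.

(** * Suprema, limits superior and the unit ball *)

Section UnitBall.
Variable R : realType.
Notation C := R[i].
Notation V := 'rV[C]_2.
Implicit Types (f : V -> C) (z w xi : V) (x y : C).

Notation fst2 z := (z ord0 ord0).
Notation snd2 z := (z ord0 (lift ord0 ord0)).

Definition point2 x y : V := \row_j (if j == ord0 then x else y).

Lemma point2_fst x y : fst2 (point2 x y) = x.
Proof. by rewrite mxE. Qed.

Lemma point2_snd x y : snd2 (point2 x y) = y.
Proof. by rewrite mxE. Qed.

Lemma point2_eta z : z = point2 (fst2 z) (snd2 z).
Proof.
apply/rowP => j; rewrite mxE; case: eqP => [->//|/eqP j0].
by congr (z ord0 _); apply/val_inj; case: j j0 => -[|[|]].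
Qed.

Definition square_norm z : R := modulus (fst2 z) ^+ 2 + modulus (snd2 z) ^+ 2.

Lemma unit_ballE z : unit_ball R 2 z = (square_norm z < 1) :> Prop.
Proof. by rewrite /unit_ball/= big_ord_recl big_ord1. Qed.

Lemma holomorphic_ball_function f (M : R) : holomorphic_on (unit_ball R 2) f ->
  (forall z, unit_ball R 2 z -> modulus (f z) <= M) ->
  ball_function M (fun x y => f (point2 x y)).
Proof.
move=> df fM; split=> [p q z [p0 [p1 [p2 pE]]] [q0 [q1 [q2 qE]]] pq|a b ab].
  have E (w : C) : point2 (p w) (q w) =
      point2 p0 q0 + w *: point2 p1 q1 + (w * w) *: point2 p2 q2.
    by apply/rowP => j; rewrite !mxE pE qE expr2; case: ifP => _; ring.
  rewrite (_ : (fun z : C => f _) = f \o (fun w : C =>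
    point2 p0 q0 + w *: point2 p1 q1 + (w * w) *: point2 p2 q2)); last first.
    by apply/funext => w /=; rewrite E.
  apply: differentiable_comp; last first.
    by apply: df; rewrite -E unit_ballE /square_norm point2_fst point2_snd.
  apply: differentiableD; first apply: differentiableD => //.
  by apply: differentiableZl; exact: differentiableM.
by apply: fM; rewrite unit_ballE /square_norm point2_fst point2_snd.
Qed.

Lemma sup_norm_leP f (M : R) : (sup_norm (unit_ball R 2) f <= M%:E)%E <->
  forall z, unit_ball R 2 z -> modulus (f z) <= M.
Proof.
split=> [H z z1|H].
  by rewrite -lee_fin (le_trans _ H)//; apply: ereal_sup_ubound; exists z.
by apply: ge_ereal_sup => _ [z z1 <-]; rewrite lee_fin; exact: H.
Qed.

Lemma modulus_continuous : continuous (@modulus R : C -> R).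
Proof.
move=> x; apply: (cvgrPdist_le (F := nbhs x) _ _).2 => e e0.
apply/nbhs_modulusP; exists e => // y yx.
have := modulus_dist x y; have := modulus_dist y x.
by rewrite [modulus (x - y)]modulusB /= ler_norml => *; apply/andP; split; lra.
Qed.

Lemma square_norm_continuous : continuous square_norm.
Proof.
have c j : continuous (fun z : V => modulus (z ord0 j) * modulus (z ord0 j) : R).
  move=> z; have cj : {for z, continuous (fun z : V => modulus (z ord0 j))}.
    apply: (@continuous_comp _ _ _ (fun z : V => z ord0 j : C)).
      exact: coord_continuous.
    exact: modulus_continuous.
  exact: (cvgM cj cj).
move=> z; rewrite (_ : square_norm = (fun z : V => modulus (fst2 z) * modulus (fst2 z))
  \+ (fun z : V => modulus (snd2 z) * modulus (snd2 z))).
  by apply: continuousD; exact: c.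
by apply/funext => w; rewrite /square_norm !expr2.
Qed.

Lemma frontier_unit_ball xi : frontier (unit_ball R 2) xi <-> square_norm xi = 1.
Proof.
have ballE : unit_ball R 2 = square_norm @^-1` [set t | t < 1].
  by apply/funext => z; rewrite unit_ballE.
have ballO : open (unit_ball R 2).
  rewrite ballE; apply: open_comp => [z _|]; first exact: square_norm_continuous.
  exact: open_lt.
rewrite /frontier (interior_id _).1//; split=> [[cl /= nb]|xi1].
  have : closure (square_norm @^-1` [set t | t <= 1]) xi.
    by apply: closureS cl => z; rewrite unit_ballE => /ltW.
  rewrite -(closure_id _).1; last first.
    apply: closed_comp => [z _|]; first exact: square_norm_continuous.
    exact: closed_le.
  move=> /= x1; apply/eqP; rewrite eq_le x1 leNgt; apply/negP => x1'.
  by apply: nb; rewrite unit_ballE.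
split; last by move=> /=; rewrite unit_ballE xi1 ltxx.
move=> B xiB.
have : nbhs (1 : C) ((fun t : C => t *: xi) @^-1` B).
  have := @scalel_continuous _ _ xi (1 : C).
  by apply; rewrite scale1r.
move=> /nbhs_modulusP[d d0 dB].
pose e : R := Num.min (d / 2) (1 / 2).
have e0 : 0 < e by rewrite lt_min; apply/andP; split; lra.
have ed : e <= d / 2 by rewrite ge_min lexx.
have e2 : e <= 1 / 2 by rewrite ge_min lexx orbT.
exists ((1 - e)%:C *: xi); split.
  rewrite unit_ballE /square_norm !mxE !modulusM modulus_real ger0_norm; last by lra.
  rewrite ![((1 - e) * _) ^+ 2]exprMn -mulrDr -/(square_norm xi) xi1; nra.
apply: dB; rewrite rmorphB rmorph1 addrAC subrr sub0r modulusN modulus_real.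
by rewrite ger0_norm ?ltW//; lra.
Qed.

Lemma limf_esup_continuous (g : V -> R) (A : set V) xi :
  {for xi, continuous g} -> closure A xi ->
  limf_esup (fun z => (g z)%:E) (within A (nbhs xi)) = (g xi)%:E.
Proof.
move=> gc Axi; apply/eqP; rewrite eq_le; apply/andP; split.
  apply/lee_addgt0Pr => e e0; rewrite limf_esupE; apply: ge_ereal_inf.
  exists (ereal_sup ((fun z => (g z)%:E) @` [set z | g z <= g xi + e])); last first.
    by apply: ge_ereal_sup => _ [z /= gz <-]; rewrite -EFinD lee_fin.
  exists [set z | g z <= g xi + e] => //.
  move/cvgrPdist_le : gc => /(_ e e0); apply: filterS => z.
  by rewrite ler_norml /= => /andP[H _] _; lra.
rewrite limf_esupE; apply: le_ereal_inf_tmp => _ [B BA <-].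
apply/lee_addgt0Pr => e e0.
have N : nbhs xi ((fun z => A z -> B z) `&` [set z | `|g xi - g z| <= e]).
  by apply: filterI => //; move/cvgrPdist_le : gc; exact.
have [z [Az [/(_ Az) Bz /= gz]]] := Axi _ N.
apply: (@le_trans _ _ ((g z)%:E + e%:E)%E).
  by rewrite -EFinD lee_fin; move: gz; rewrite ler_norml => /andP[_]; lra.
by rewrite leeD2r//; apply: ereal_sup_ubound; exists z.
Qed.

End UnitBall.

(** * The extremal problem *)

Section Extremal.
Variable R : realType.
Notation C := R[i].
Notation V := 'rV[C]_2.
Notation fst2 z := (z ord0 ord0).
Notation snd2 z := (z ord0 (lift ord0 ord0)).

Definition twice_product (z : V) : C := 2 * fst2 z * snd2 z.

Definition node (j : 'I_4) : V := nth 0 [:: point2 0 0; point2 2^-1 2^-1;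
  point2 (- 2^-1) (- 2^-1); point2 2^-1 (- 2^-1)] j.

Definition node_value (j : 'I_4) : C := nth 0 [:: 0; 2^-1; 2^-1; - 2^-1] j.

Lemma point2_eq (x y x' y' : C) :
  (point2 x y == point2 x' y') = (x == x') && (y == y').
Proof.
apply/eqP/andP => [/rowP E|[/eqP-> /eqP->]//].
by have := E ord0; have := E (lift ord0 ord0); rewrite !mxE/= => -> ->.
Qed.

Lemma node_inj : injective node.
Proof.
have h0 : (2^-1 == 0 :> C) = false by rewrite invr_eq0 pnatr_eq0.
have hN : (2^-1 == - 2^-1 :> C) = false by rewrite eq_sym eqNr h0.
move=> i j /eqP; rewrite nth_uniq//; first by move/eqP/val_inj.
rewrite /= !inE !point2_eq !(eq_sym 0) !oppr_eq0 ![- _ == 2^-1]eq_sym.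
by rewrite !h0 !hN !eqxx.
Qed.

Lemma node_ball j : unit_ball R 2 (node j).
Proof.
have h2 : modulus (2^-1 : C) = 1 / 2.
  by rewrite modulusV modulus_nat mul1r.
rewrite unit_ballE /node; case: j => -[|[|[|[|//]]]] /= _;
  rewrite /square_norm point2_fst point2_snd ?modulusN ?h2 ?modulus0; lra.
Qed.

Lemma product_interpolates j : twice_product (node j) = node_value j.
Proof.
have h2 : 2 * 2^-1 = 1 :> C by rewrite divff// pnatr_eq0.
rewrite /node /node_value; case: j => -[|[|[|[|//]]]] /= _;
  rewrite /twice_product point2_fst point2_snd ?mulr0//.
- by rewrite h2 mul1r.
- by rewrite mulrN (mulrN 2) mulNr opprK h2 mul1r.
- by rewrite mulrN h2 mul1r.
Qed.

Lemma modulus_product (z : V) :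
  modulus (twice_product z) = 2 * (modulus (fst2 z) * modulus (snd2 z)).
Proof.
rewrite /twice_product -mulrA (modulusM 2) (modulusM (fst2 z)).
by rewrite modulus_nat.
Qed.

Lemma product_differentiable (z : V) : differentiable twice_product z.
Proof.
apply: differentiableM; last exact: differentiable_coord.
by apply: differentiableM => //; exact: differentiable_coord.
Qed.

Lemma modulus_product_le1 (z : V) : square_norm z <= 1 ->
  modulus (twice_product z) <= 1.
Proof.
move=> z1; rewrite modulus_product.
by have := modulus_product_le (fst2 z) (snd2 z); rewrite /square_norm in z1; lra.
Qed.

(** The largest value is approached along the diagonal. *)
Lemma sup_norm_product : sup_norm (unit_ball R 2) twice_product = 1%E.
Proof.
apply/eqP; rewrite eq_le; apply/andP; split.
  apply/sup_norm_leP => z; rewrite unit_ballE => /ltW; exact: modulus_product_le1.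
apply/lee_addgt0Pr => e e0.
pose t : R := Num.max (1 - e) (1 / 2).
have t1 : t < 1 by rewrite gt_max; apply/andP; split; lra.
have te : 1 - e <= t by rewrite le_max lexx.
have t2 : 1 / 2 <= t by rewrite le_max lexx orbT.
pose x : C := (Num.sqrt (t / 2))%:C.
have mx : modulus x ^+ 2 = t / 2.
  by rewrite modulus_real real_normK ?num_real// sqr_sqrtr//; lra.
apply: (@le_trans _ _ ((modulus (twice_product (point2 x x)))%:E + e%:E)%E).
  rewrite -EFinD lee_fin modulus_product point2_fst point2_snd -expr2 mx; lra.
rewrite leeD2r//; apply: ereal_sup_ubound; exists (point2 x x) => //.
by rewrite unit_ballE /square_norm point2_fst point2_snd mx; lra.
Qed.

Lemma product_Hinfty : Hinfty (unit_ball R 2) twice_product.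
Proof.
split; first by move=> z _; exact: product_differentiable.
by rewrite sup_norm_product ltry.
Qed.

Lemma interpolant_unique (g : V -> C) :
  interpolants (unit_ball R 2) node node_value g ->
  (sup_norm (unit_ball R 2) g <= 1)%E ->
  forall z, unit_ball R 2 z -> g z = twice_product z.
Proof.
move=> [[dg _] gv] /sup_norm_leP g1 z z1.
have gB := holomorphic_ball_function dg g1.
rewrite [z]point2_eta /twice_product point2_fst point2_snd.
apply: (four_point_uniqueness gB).
- exact: (gv (Ordinal (isT : (0 < 4)%N))).
- exact: (gv (Ordinal (isT : (1 < 4)%N))).
- exact: (gv (Ordinal (isT : (2 < 4)%N))).
- exact: (gv (Ordinal (isT : (3 < 4)%N))).
- by rewrite unit_ballE in z1.
Qed.

Lemma eq_sup_norm (f g : V -> C) :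
  (forall z, unit_ball R 2 z -> f z = g z) ->
  sup_norm (unit_ball R 2) f = sup_norm (unit_ball R 2) g.
Proof.
move=> fg; congr ereal_sup; apply/seteqP.
by split=> _ [z z1 <-]; exists z => //; rewrite fg.
Qed.

Lemma extremal_value :
  ereal_inf [set sup_norm (unit_ball R 2) h |
    h in interpolants (unit_ball R 2) node node_value] = 1%E.
Proof.
apply/eqP; rewrite eq_le; apply/andP; split.
  apply: ge_ereal_inf; exists (sup_norm (unit_ball R 2) twice_product).
    exists twice_product; last by [].
    by split; [exact: product_Hinfty|exact: product_interpolates].
  by rewrite sup_norm_product.
apply: le_ereal_inf_tmp => _ [h hI <-]; rewrite leNgt; apply/negP => h1.
have := eq_sup_norm (interpolant_unique hI (ltW h1)).
by rewrite sup_norm_product => E; rewrite E ltxx in h1.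
Qed.

(** Equality in 2|x||y| <= |x|^2 + |y|^2 = 1 cuts out the torus. *)
Lemma max_modulus_product :
  max_modulus_set (unit_ball R 2) twice_product =
  range (@torus_map R (Num.sqrt (1 / 2)) 2).
Proof.
have h2 : Num.sqrt (1 / 2) ^+ 2 = 1 / 2 :> R by rewrite sqr_sqrtr.
have h0 : 0 < Num.sqrt (1 / 2) :> R by rewrite sqrtr_gt0.
have modc (xi : V) : {for xi, continuous (fun z => modulus (twice_product z))}.
  apply: (@continuous_comp _ _ _ twice_product).
    by apply: differentiable_continuous; exact: product_differentiable.
  exact: modulus_continuous.
have limE (xi : V) : frontier (unit_ball R 2) xi ->
    limf_esup (fun z => (modulus (twice_product z))%:E)
      (within (unit_ball R 2) (nbhs xi)) = (modulus (twice_product xi))%:E.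
  by move=> [cl _]; exact: limf_esup_continuous.
apply/seteqP; split=> xi.
  rewrite /max_modulus_set/= => -[fr].
  rewrite limE// sup_norm_product => -[]; rewrite modulus_product => E.
  have := (frontier_unit_ball xi).1 fr; rewrite /square_norm => xi1.
  have d0 : (modulus (fst2 xi) - modulus (snd2 xi)) ^+ 2 = 0.
    by rewrite sqrrB mulr2n; lra.
  have {}d0 : modulus (fst2 xi) = modulus (snd2 xi).
    by apply/eqP; rewrite -subr_eq0 -sqrf_eq0 d0.
  have m0 := modulus_ge0 (snd2 xi).
  have mh : modulus (snd2 xi) = Num.sqrt (1 / 2).
    apply/eqP; rewrite -(@eqrXn2 _ 2)// ?ltW// h2.
    by apply/eqP; rewrite d0 in xi1; lra.
  apply/(range_torus_map _ h0) => j; rewrite [xi]point2_eta mxE.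
  by case: ifP; rewrite ?d0.
move=> /(range_torus_map _ h0) xih.
have fr : frontier (unit_ball R 2) xi.
  by apply/frontier_unit_ball; rewrite /square_norm !xih h2; lra.
split=> //; rewrite limE// sup_norm_product modulus_product !xih -expr2 h2.
by congr EFin; lra.
Qed.

End Extremal.

Local Close Scope classical_set_scope.

Theorem theorem12 (R : realType) :
  exists (a : 'I_4 -> 'rV[R[i]]_2) (v : 'I_4 -> R[i]),
    [/\ injective a,
        (forall j, unit_ball R 2 (a j)) &
        exists f0 : 'rV[R[i]]_2 -> R[i],
          [/\ extremal_solution (unit_ball R 2) a v f0,
              (forall g, extremal_solution (unit_ball R 2) a v g ->
                 forall z, unit_ball R 2 z -> g z = f0 z) &
              is_torus 2 (max_modulus_set (unit_ball R 2) f0)]].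
Proof.
exists (@node R), (@node_value R); split.
- exact: node_inj.
- exact: node_ball.
exists (@twice_product R); split.
- split; last by rewrite extremal_value sup_norm_product.
  by split; [exact: product_Hinfty|exact: product_interpolates].
- by move=> g [gI gE]; apply: interpolant_unique => //; rewrite gE extremal_value.
- by rewrite max_modulus_product; apply: torus_map_is_torus; rewrite sqrtr_gt0.
Qed.
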